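(* Assume the van Kampen setup below with $B_k=X_k$ for $k=0,1,2$, and let $P_k:\vec\pi_1(X_k)\to\vec\pi_1(X_k,A_k)$, $k=0,1,2$, be compatible future retracts. Then the commutative square of categories $$\begin{array}{ccc}\vec\pi_1(X_0,A_0)&\xrightarrow{i'_2}&\vec\pi_1(X_2,A_2)\\ \downarrow{\scriptstyle i'_1}&&\downarrow{\scriptstyle j'_2}\\ \vec\pi_1(X_1,A_1)&\xrightarrow{j'_1}&\vec\pi_1(X,A)\end{array}$$ (all functors induced by inclusions) is a pushout in the category of (small) categories.
   Context: A d-space is a topological space with a set of continuous paths $[0,1]\to X$ (dipaths) containing all constant paths, closed under precomposition with continuous non-decreasing maps $[0,1]\to[0,1]$ and under concatenation; subsets carry the dipaths with image in them; a dimap is a continuous map preserving dipaths. $\vec I$ is $[0,1]$ with non-decreasing paths as dipaths. The fundamental category $\vec\pi_1(X)$ has objects the points of $X$ and morphisms $a\to b$ the classes of dipaths from $a$ to $b$ modulo the equivalence relation generated by endpoint-fixing directed homotopies (dimaps $H:\vec I\times\vec I\to X$ with $H(\cdot,0)=\gamma$, $H(\cdot,1)=\gamma'$, $H(0,s)=a$, $H(1,s)=b$); composition is concatenation. For $A\subseteq X$, $\vec\pi_1(X,A)$ is the full subcategory on objects in $A$. Inclusions induce functors. For $A\subseteq B\subseteq X$ with inclusion $\iota:\vec\pi_1(X,A)\to\vec\pi_1(X,B)$, a future retract is a functor $P:\vec\pi_1(X,B)\to\vec\pi_1(X,A)$ left adjoint to $\iota$ whose unit $\eta$ satisfies $\eta_a=\mathrm{id}_a$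 for $a\in A$. Van Kampen setup: $X$ a d-space, $X_1,X_2\subseteq X$ with $X=\mathrm{Int}(X_1)\cup\mathrm{Int}(X_2)$, dipaths of $X$ being the finite concatenations of dipaths of $X_1$ and $X_2$, $X_0=X_1\cap X_2$. For $k=0,1,2$, $A_k\subseteq B_k\subseteq X_k$ with $A_0=A_1\cap A_2$, $B_0=B_1\cap B_2$, $A=A_1\cup A_2$, $B=B_1\cup B_2$, $A=\mathrm{Int}_A(A_1)\cup\mathrm{Int}_A(A_2)$, $B=\mathrm{Int}_B(B_1)\cup\mathrm{Int}_B(B_2)$. Inclusion-induced functors: $i_k:\vec\pi_1(X_0,B_0)\to\vec\pi_1(X_k,B_k)$, $j_k:\vec\pi_1(X_k,B_k)\to\vec\pi_1(X,B)$, $i'_k:\vec\pi_1(X_0,A_0)\to\vec\pi_1(X_k,A_k)$, $j'_k:\vec\pi_1(X_k,A_k)\to\vec\pi_1(X,A)$ ($k=1,2$). Functors $P_k:\vec\pi_1(X_k,B_k)\to\vec\pi_1(X_k,A_k)$ ($k=0,1,2$) are compatible future retracts if each is a future retract with unit $\eta^k$, $P_k\circ i_k=i'_k\circ P_0$ for $k=1,2$, and for each $x\in B_0$ the image of $\eta^0_x$ in $\vec\pi_1(X_k)$ equals $\eta^k_x$. *)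

(* Defs.v *)
From HB Require Import structures.
From mathcomp Require Import all_boot all_order all_algebra.
From mathcomp Require Import all_classical all_reals all_analysis.
From mathcomp Require Import lra.
From Stdlib Require Import Relations ClassicalEpsilon.
Set Implicit Arguments. Unset Strict Implicit. Unset Printing Implicit Defensive.
Import Order.TTheory GRing.Theory Num.Theory.
Import numFieldNormedType.Exports.
Local Open Scope classical_set_scope.
Local Open Scope ring_scope.

Record PreCat := {
  Ob : Type;
  Mor : Ob -> Ob -> Type;
  idm : forall a, Mor a a;
  comp : forall a b c, Mor a b -> Mor b c -> Mor a c
}.
Arguments Mor : clear implicits.
Arguments idm {p} a.
Arguments comp {p a b c} f g.

Record Category := {
  cpre :> PreCat;
  cat_idl : forall a b (f : Mor cpre a b), comp (idm a) f = f;
  cat_idr : forall a b (f : Mor cpre a b), comp f (idm b) = f;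
  cat_assoc : forall a b c d (f : Mor cpre a b) (g : Mor cpre b c) (h : Mor cpre c d),
      comp (comp f g) h = comp f (comp g h)
}.

Record FunctorData (C D : PreCat) := {
  fob : Ob C -> Ob D;
  fmor : forall a b, Mor C a b -> Mor D (fob a) (fob b)
}.
Arguments fob {C D} f x.
Arguments fmor {C D} f {a b} m.

Definition fcomp {C D E : PreCat} (F : FunctorData C D) (G : FunctorData D E) :
  FunctorData C E :=
  {| fob := fun x => fob G (fob F x); fmor := fun a b m => fmor G (fmor F m) |}.

Definition is_functor {C D : PreCat} (F : FunctorData C D) : Prop :=
  (forall a, fmor F (idm a) = idm (fob F a)) /\
  (forall a b c (f : Mor C a b) (g : Mor C b c),
      fmor F (comp f g) = comp (fmor F f) (fmor F g)).

Definition is_pushout {C0 C1 C2 D : PreCat}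
  (f1 : FunctorData C0 C1) (f2 : FunctorData C0 C2)
  (g1 : FunctorData C1 D) (g2 : FunctorData C2 D) : Prop :=
  fcomp f1 g1 = fcomp f2 g2 /\
  forall (E : Category) (h1 : FunctorData C1 E) (h2 : FunctorData C2 E),
    is_functor h1 -> is_functor h2 -> fcomp f1 h1 = fcomp f2 h2 ->
    exists! h : FunctorData D E,
      is_functor h /\ fcomp g1 h = h1 /\ fcomp g2 h = h2.

(* P : CB -> CA is left adjoint to iota : CA -> CB with unit eta, and
   eta_a = id_a for every object a of CA ("future retract") *)
Definition future_retract {CA CB : PreCat} (iota : FunctorData CA CB)
  (P : FunctorData CB CA) (eta : forall x : Ob CB, Mor CB x (fob iota (fob P x))) : Prop :=
  is_functor P /\
  (forall x y (f : Mor CB x y), comp f (eta y) = comp (eta x) (fmor iota (fmor P f))) /\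
  (forall x (a : Ob CA) (f : Mor CB x (fob iota a)),
      exists! g : Mor CA (fob P x) a, comp (eta x) (fmor iota g) = f) /\
  (forall a : Ob CA,
      existT (fun y => Mor CB (fob iota a) y) (fob iota (fob P (fob iota a))) (eta (fob iota a))
      = existT (fun y => Mor CB (fob iota a) y) (fob iota a) (idm (fob iota a))).

(* d-spaces.  A path [0,1] -> X is encoded as a function R -> X whose   *)
(* values outside [0,1] are irrelevant.                                 *)

Section DSpace.
Variable R : realType.

Definition I01 : set R := [set t | 0 <= t <= 1].

(* continuous non-decreasing maps [0,1] -> [0,1] (= dipaths of vec I) *)
Definition nondec01 (phi : R -> R) : Prop :=
  {within I01, continuous phi} /\ (forall t, I01 t -> I01 (phi t)) /\
  (forall s t, I01 s -> I01 t -> s <= t -> phi s <= phi t).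

Definition concat {T : Type} (g h : R -> T) : R -> T :=
  fun t => if t <= 2^-1 then g (2 * t) else h (2 * t - 1).

Record dspace := DSpace {
  dcar :> topologicalType;
  dipath : set (R -> dcar);
  dipath_cont : forall g, dipath g -> {within I01, continuous g};
  dipath_ext : forall g g', dipath g -> (forall t, I01 t -> g t = g' t) -> dipath g';
  dipath_const : forall x : dcar, dipath (fun _ => x);
  dipath_reparam : forall g phi, dipath g -> nondec01 phi -> dipath (g \o phi);
  dipath_concat : forall g h, dipath g -> dipath h -> g 1 = h 0 -> dipath (concat g h)
}.
Arguments dipath : clear implicits.

Section Fund.
Variable X : dspace.

Definition dipath_in (Y : set X) (g : R -> X) : Prop :=
  dipath X g /\ (forall t, I01 t -> Y (g t)).

Definition Isq : set (R * R) := [set p | I01 p.1 /\ I01 p.2].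

(* dimaps vec I x vec I -> Y *)
Definition dimap_sq (Y : set X) (H : R * R -> X) : Prop :=
  {within Isq, continuous H} /\
  (forall p q, nondec01 p -> nondec01 q -> dipath_in Y (fun t => H (p t, q t))).

Definition dhtpy (Y : set X) (a b : X) (g g' : R -> X) : Prop :=
  exists H, dimap_sq Y H /\
    (forall t, I01 t -> H (t, 0) = g t) /\ (forall t, I01 t -> H (t, 1) = g' t) /\
    (forall s, I01 s -> H (0, s) = a /\ H (1, s) = b).

Definition dihom (Y : set X) (a b : X) := clos_refl_sym_trans _ (dhtpy Y a b).

Definition dclass (Y : set X) (a b : X) (g : R -> X) : set (R -> X) :=
  [set g' | dipath_in Y g' /\ dihom Y a b g g'].

Definition is_morph (Y : set X) (a b : X) (C : set (R -> X)) : Prop :=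
  exists g, dipath_in Y g /\ g 0 = a /\ g 1 = b /\ C = dclass Y a b g.

Definition rep (Y : set X) (a b : X) (f : {C : set (R -> X) | is_morph Y a b C}) : R -> X :=
  proj1_sig (constructive_indefinite_description _ (proj2_sig f)).

Lemma rep_spec (Y : set X) (a b : X) (f : {C : set (R -> X) | is_morph Y a b C}) :
  dipath_in Y (rep f) /\ rep f 0 = a /\ rep f 1 = b.
Proof.
rewrite /rep; case: constructive_indefinite_description => g [h1 [h2 [h3 _]]] /=.
by split.
Qed.

Lemma cst_morph (Y : set X) (a : X) : Y a -> is_morph Y a a (dclass Y a a (fun _ => a)).
Proof.
move=> Ya; exists (fun _ => a); split => //; split => //.
exact: dipath_const.
Qed.

Lemma concat_morph (Y : set X) (a b c : X)
  (f : {C : set (R -> X) | is_morph Y a b C}) (g : {C : set (R -> X) | is_morph Y b c C}) :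
  is_morph Y a c (dclass Y a c (concat (rep f) (rep g))).
Proof.
have [[df Yf] [f0 f1]] := rep_spec f.
have [[dg Yg] [g0 g1]] := rep_spec g.
exists (concat (rep f) (rep g)); split; last split; last split => //.
- split; first by apply: dipath_concat => //; rewrite f1 g0.
  move=> t /andP [t0 t1]; rewrite /concat; case: ifP => ht.
  + by apply: Yf; rewrite /I01 /=; apply/andP; split; lra.
  + apply: Yg; rewrite /I01 /=; move/negbT: ht; rewrite -ltNge => ht.
    by apply/andP; split; lra.
- by rewrite /concat ifT ?mulr0 //; lra.
- by rewrite /concat ifF ?mulr1 1?addrK_sub ?g1 //; [rewrite (_ : 2 - 1 = 1) //; lra | lra].
Qed.

Lemma incl_morph (Y Y' : set X) (a b : X) (hY : Y `<=` Y')
  (f : {C : set (R -> X) | is_morph Y a b C}) : is_morph Y' a b (dclass Y' a b (rep f)).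
Proof.
have [[df Yf] [f0 f1]] := rep_spec f.
exists (rep f); split => //; split => // t /Yf; exact: hY.
Qed.

Definition pi (Y A : set X) (hAY : A `<=` Y) : PreCat := {|
  Ob := {x : X | A x};
  Mor := fun a b => {C : set (R -> X) | is_morph Y (sval a) (sval b) C};
  idm := fun a => exist _ (dclass Y (sval a) (sval a) (fun _ => sval a))
                        (cst_morph (hAY _ (svalP a)));
  comp := fun a b c f g =>
            exist _ (dclass Y (sval a) (sval c) (concat (rep f) (rep g))) (concat_morph f g)
|}.

Definition incl (Y Y' A A' : set X) (hAY : A `<=` Y) (hAY' : A' `<=` Y')
  (hY : Y `<=` Y') (hA : A `<=` A') : FunctorData (pi hAY) (pi hAY') :=
  @Build_FunctorData (pi hAY) (pi hAY')
    (fun x => exist (fun y => A' y) (sval x) (hA _ (svalP x)))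
    (fun a b f => exist _ (dclass Y' (sval a) (sval b) (rep f)) (incl_morph hY f)).

Definition relint (A S : set X) : set X :=
  [set x | A x /\ exists U, open U /\ U x /\ U `&` A `<=` S].

Definition fin_concat (X1 X2 : set X) (g : R -> X) : Prop :=
  exists (n : nat) (t : nat -> R), t 0%N = 0 /\ t n = 1 /\
    (forall i, (i < n)%N -> t i <= t i.+1) /\
    (forall i, (i < n)%N ->
       (forall u, t i <= u <= t i.+1 -> X1 (g u)) \/
       (forall u, t i <= u <= t i.+1 -> X2 (g u))).

Lemma subrefl (A : set X) : A `<=` A. Proof. by []. Qed.
Lemma subT (A : set X) : A `<=` setT. Proof. by []. Qed.
Lemma subI2 (A B C D : set X) : A `<=` C -> B `<=` D -> A `&` B `<=` C `&` D.
Proof. by move=> h1 h2 x [/h1 ? /h2 ?]. Qed.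

Section VK.
Variables (X1 X2 A1 A2 : set X) (hA1 : A1 `<=` X1) (hA2 : A2 `<=` X2).

Definition hA0 : A1 `&` A2 `<=` X1 `&` X2 := subI2 hA1 hA2.

Definition piB0 := @pi (X1 `&` X2) (X1 `&` X2) (@subrefl _).
Definition piB1 := @pi X1 X1 (@subrefl _).
Definition piB2 := @pi X2 X2 (@subrefl _).
Definition piA0 := @pi (X1 `&` X2) (A1 `&` A2) hA0.
Definition piA1 := @pi X1 A1 hA1.
Definition piA2 := @pi X2 A2 hA2.
Definition piA := @pi setT (A1 `|` A2) (@subT _).

Definition i1' : FunctorData piA0 piA1 :=
  @incl _ _ _ _ hA0 hA1 (@subIsetl _ X1 X2) (@subIsetl _ A1 A2).
Definition i2' : FunctorData piA0 piA2 :=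
  @incl _ _ _ _ hA0 hA2 (@subIsetr _ X1 X2) (@subIsetr _ A1 A2).
Definition j1' : FunctorData piA1 piA :=
  @incl _ _ _ _ hA1 (@subT _) (@subT X1) (@subsetUl _ A1 A2).
Definition j2' : FunctorData piA2 piA :=
  @incl _ _ _ _ hA2 (@subT _) (@subT X2) (@subsetUr _ A1 A2).
Definition i1 : FunctorData piB0 piB1 :=
  @incl _ _ _ _ (@subrefl _) (@subrefl _) (@subIsetl _ X1 X2) (@subIsetl _ X1 X2).
Definition i2 : FunctorData piB0 piB2 :=
  @incl _ _ _ _ (@subrefl _) (@subrefl _) (@subIsetr _ X1 X2) (@subIsetr _ X1 X2).
Definition iota0 : FunctorData piA0 piB0 := @incl _ _ _ _ hA0 (@subrefl _) (@subrefl _) hA0.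
Definition iota1 : FunctorData piA1 piB1 := @incl _ _ _ _ hA1 (@subrefl _) (@subrefl _) hA1.
Definition iota2 : FunctorData piA2 piB2 := @incl _ _ _ _ hA2 (@subrefl _) (@subrefl _) hA2.

Definition compatible_future_retracts
  (P0 : FunctorData piB0 piA0) (P1 : FunctorData piB1 piA1) (P2 : FunctorData piB2 piA2)
  (eta0 : forall x : Ob piB0, Mor piB0 x (fob iota0 (fob P0 x)))
  (eta1 : forall x : Ob piB1, Mor piB1 x (fob iota1 (fob P1 x)))
  (eta2 : forall x : Ob piB2, Mor piB2 x (fob iota2 (fob P2 x))) : Prop :=
  @future_retract _ _ iota0 P0 eta0 /\ @future_retract _ _ iota1 P1 eta1 /\
  @future_retract _ _ iota2 P2 eta2 /\
  fcomp i1 P1 = fcomp P0 i1' /\ fcomp i2 P2 = fcomp P0 i2' /\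
  (forall x : Ob piB0,
     existT (fun y => Mor piB1 (fob i1 x) y) _ (fmor i1 (eta0 x))
     = existT (fun y => Mor piB1 (fob i1 x) y) _ (eta1 (fob i1 x))) /\
  (forall x : Ob piB0,
     existT (fun y => Mor piB2 (fob i2 x) y) _ (fmor i2 (eta0 x))
     = existT (fun y => Mor piB2 (fob i2 x) y) _ (eta2 (fob i2 x))).

End VK.
End Fund.
End DSpace.
Arguments dipath {R} d _.

(* Main.v *)
Require Import Defs.
From HB Require Import structures.
From mathcomp Require Import all_boot all_order all_algebra.
From mathcomp Require Import all_classical all_reals all_analysis.
From mathcomp Require Import lra ring.
From Stdlib Require Import Relations.
From Stdlib Require ClassicalEpsilon.
Import Defs.
Set Implicit Arguments. Unset Strict Implicit. Unset Printing Implicit Defensive.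
Import Order.TTheory GRing.Theory Num.Theory.
Import numFieldNormedType.Exports.
Local Open Scope classical_set_scope.
Local Open Scope ring_scope.

(** Directed van Kampen theorem, followed by a retraction.  A cocone [h1], [h2] under the square
    of the [A_k] yields, by precomposition with [P_k], values for the dipaths that stay in one
    [X_k].  A general dipath is bisected until all its pieces are such dipaths, and its value is
    the composite of their values.  Subdividing a directed homotopy into small squares, each of
    which commutes in one [X_k], shows that the value only depends on the homotopy class, whence a
    functor on the fundamental category of [X], which is then restricted to [A].  Since
    [P_k iota_k = id], it extends [h1] and [h2].  For uniqueness, the units [eta^k] glue to a
    transformation which is natural along composites of small dipaths and trivial over [A]; so a
    dipath between points of [A] is homotopic to a composite of classes coming from the [A_k]. *)

(** The subdivision points of a dipath between points of [A] need not lie in [A], so its pieces are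
    not morphisms of the categories in the square; the retracts move these points into [A], both
    when values are defined and when uniqueness is proved. Values on small paths are unambiguous
    because a path in both [X1] and [X2] can be retracted by [P0] first. Subdivisions are dyadic so
    that two of them have a common refinement and so that cutting a path undoes [concat] exactly,
    without reparametrization. Homotopies are directed in their parameter too and cannot be run
    backwards: two paths are compared by joining both to a third one that dominates them, and the
    generated equivalence relation does the rest. To keep equalities of end points out of the types,
    values are computed on paths rather than on classes, as arrows packed with their ends. *)

(** * Continuity on the interval and on the square *)

Section Retraction.
Variables (U V : topologicalType) (A : set U) (r : U -> U).
Hypotheses (rcont : continuous r) (rA : forall u, A (r u))
  (rid : forall u, A u -> r u = u).

(** Trades continuity relative to [A] for plain continuity on the ambient space, where composition
    and pasting need no subspace topologies. *)
Lemma within_continuous_retract (f : U -> V) :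
  {within A, continuous f} <-> continuous (f \o r).
Proof.
split=> [/subspace_continuousP fc u|fc].
  apply: (@cvg_comp _ _ _ r f (nbhs u) (within A (nbhs (r u)))); last exact: fc.
  move=> W WA; have := rcont WA; rewrite /= !nbhs_simpl /=.
  by apply: filterS => x /=; exact.
apply: (@subspace_eq_continuous _ A V (f \o r)).
  by move=> u; rewrite inE => Au /=; rewrite rid.
exact: continuous_subspaceT.
Qed.
End Retraction.

(** Pasting along the two closed sets [c <= r] and [r <= c], which overlap only where [c = r]. *)
Lemma continuous_if (T U : topologicalType) (R : realType) (c : T -> R) (r : R)
    (f g : T -> U) : continuous c -> continuous f -> continuous g ->
  (forall x, c x = r -> f x = g x) ->
  continuous (fun x => if c x <= r then f x else g x).
Proof.
move=> cc cf cg fg.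
have E : [set: T] = [set x | c x <= r] `|` [set x | r <= c x].
  apply/seteqP; split=> x _ //=; case: (leP (c x) r) => h; [by left|right; exact: ltW].
have cl1 : closed [set x | c x <= r].
  by apply: (closed_comp (f := c) (D := [set y | y <= r])) => //; exact: closed_le.
have cl2 : closed [set x | r <= c x].
  by apply: (closed_comp (f := c) (D := [set y | r <= y])) => //; exact: closed_ge.
have : {within [set x | c x <= r] `|` [set x | r <= c x],
   continuous (fun x => if c x <= r then f x else g x)}.
  apply: withinU_continuous => //.
    apply: (@subspace_eq_continuous _ _ _ f); last exact: continuous_subspaceT.
    by move=> x; rewrite inE /from_subspace /= => ->.
  apply: (@subspace_eq_continuous _ _ _ g); last exact: continuous_subspaceT.
  move=> x; rewrite inE /from_subspace /= => h; case: ifP => // h'.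
  by rewrite fg //; apply/eqP; rewrite eq_le h h'.
by rewrite -E => h; apply/continuous_subspace_setT.
Qed.

Section Clamp.
Variable R : realType.

Definition clamp (t : R) : R := Num.max 0 (Num.min t 1).
Definition clamp2 (p : R * R) : R * R := (clamp p.1, clamp p.2).

Lemma I01_clamp t : I01 (clamp t).
Proof. by rewrite /I01 /= /clamp; apply/andP; split; rewrite /Num.max /Num.min; do 2?case: ifP; lra. Qed.

Lemma clamp_id t : I01 t -> clamp t = t.
Proof. by rewrite /I01 /= /clamp /Num.max /Num.min => /andP[? ?]; do 2?case: ifP; lra. Qed.

Lemma clamp_continuous : continuous clamp.
Proof.
move=> t; apply: (@continuous_max R R (fun=> 0) (fun t => Num.min t 1)).
  exact: cvg_cst.
by apply: (@continuous_min R R (fun t => t) (fun=> 1)); [exact: cvg_id|exact: cvg_cst].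
Qed.

Lemma pair_continuous (T U V : topologicalType) (f : T -> U) (g : T -> V) :
  continuous f -> continuous g -> continuous (fun x => (f x, g x)).
Proof. by move=> cf cg x; apply: cvg_pair; [exact: cf|exact: cg]. Qed.

Lemma comp_continuous (T U V : topologicalType) (f : T -> U) (g : U -> V) :
  continuous f -> continuous g -> continuous (fun x => g (f x)).
Proof. by move=> cf cg x; apply: (@continuous_comp _ _ _ f g); [exact: cf|exact: cg]. Qed.

Lemma fst_continuous (U V : topologicalType) : continuous (@fst U V).
Proof. by move=> x; exact: cvg_fst. Qed.
Lemma snd_continuous (U V : topologicalType) : continuous (@snd U V).
Proof. by move=> x; exact: cvg_snd. Qed.

Lemma clamp2_continuous : continuous clamp2.
Proof.
apply: pair_continuous; apply: comp_continuous.
- exact: fst_continuous.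
- exact: clamp_continuous.
- exact: snd_continuous.
- exact: clamp_continuous.
Qed.

Lemma continuous_I01P (V : topologicalType) (f : R -> V) :
  {within @I01 R, continuous f} <-> continuous (fun t => f (clamp t)).
Proof.
apply: (within_continuous_retract clamp_continuous); [exact: I01_clamp|exact: clamp_id].
Qed.

Lemma continuous_IsqP (V : topologicalType) (f : R * R -> V) :
  {within @Isq R, continuous f} <-> continuous (fun t => f (clamp2 t)).
Proof.
apply: (within_continuous_retract clamp2_continuous).
- by move=> u; split; exact: I01_clamp.
- by case=> u v [/= /clamp_id e1 /clamp_id e2]; rewrite /clamp2 /= e1 e2.
Qed.

Lemma addf_continuous (T : topologicalType) (f g : T -> R) :
  continuous f -> continuous g -> continuous (fun x => f x + g x).
Proof. by move=> cf cg x; apply: cvgD; [exact: cf|exact: cg]. Qed.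
Lemma mulf_continuous (T : topologicalType) (f g : T -> R) :
  continuous f -> continuous g -> continuous (fun x => f x * g x).
Proof. by move=> cf cg x; apply: cvgM; [exact: cf|exact: cg]. Qed.
Lemma oppf_continuous (T : topologicalType) (f : T -> R) :
  continuous f -> continuous (fun x => - f x).
Proof. by move=> cf x; apply: cvgN; exact: cf. Qed.
Lemma maxf_continuous (T : topologicalType) (f g : T -> R) :
  continuous f -> continuous g -> continuous (fun x => Num.max (f x) (g x)).
Proof. by move=> cf cg x; apply: (@continuous_max R T f g); [exact: cf|exact: cg]. Qed.
Lemma minf_continuous (T : topologicalType) (f g : T -> R) :
  continuous f -> continuous g -> continuous (fun x => Num.min (f x) (g x)).
Proof. by move=> cf cg x; apply: (@continuous_min R T f g); [exact: cf|exact: cg]. Qed.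

End Clamp.

Ltac prove_continuous := repeat first [ assumption
  | match goal with |- continuous (fun _ => ?c) => exact: cst_continuous end
  | match goal with |- continuous (fun x => x) => move=> ?; exact: cvg_id end
  | exact: fst_continuous | exact: snd_continuous
  | exact: clamp_continuous
  | exact: clamp2_continuous
  | apply: pair_continuous | apply: addf_continuous | apply: mulf_continuous
  | apply: oppf_continuous | apply: maxf_continuous | apply: minf_continuous
  | match goal with |- continuous (fun x => clamp _) =>
      apply: comp_continuous; last exact: clamp_continuous end
  | match goal with |- continuous (fun x => clamp2 _) =>
      apply: comp_continuous; last exact: clamp2_continuous end ].
Ltac case_minmax := rewrite /Num.max /Num.min;
  repeat match goal with |- context [if ?b then _ else _] =>
    lazymatch b with
    | context [if _ then _ else _] => fail
    | _ => let h := fresh in case h : b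
    end end.

(** * Non-decreasing reparametrizations *)

Section Nondec.
Variable R : realType.
Implicit Types p q : R -> R.

Lemma I01_0 : @I01 R 0. Proof. by rewrite /I01 /= lexx ler01. Qed.
Lemma I01_1 : @I01 R 1. Proof. by rewrite /I01 /= lexx ler01. Qed.
Hint Resolve I01_0 I01_1 : core.

Lemma nondec01_cont p : nondec01 p -> continuous (fun t => p (clamp t)).
Proof. by case=> /continuous_I01P. Qed.

Lemma nondec01_id : nondec01 (fun t : R => t).
Proof. by split=> //; apply/continuous_I01P; prove_continuous. Qed.

Lemma nondec01_cst (c : R) : I01 c -> nondec01 (fun _ : R => c).
Proof. by move=> ?; split=> //; apply/continuous_I01P; prove_continuous. Qed.

Lemma nondec01_comp p q : nondec01 p -> nondec01 q -> nondec01 (fun t => p (q t)).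
Proof.
move=> [pc [pI pm]] [qc [qI qm]]; split; last split.
- apply/continuous_I01P.
  rewrite (_ : (fun t => _) = (fun t => (fun u => p (clamp u)) (q (clamp t)))).
    by apply: (@comp_continuous _ _ _ (fun t => q (clamp t)) (fun u => p (clamp u)));
      exact/continuous_I01P.
  by apply/funext => t; rewrite [clamp (q _)]clamp_id //; apply: qI; exact: I01_clamp.
- by move=> t tI; apply: pI; apply: qI.
- by move=> s t sI tI st; apply: pm; [exact: qI|exact: qI|exact: qm].
Qed.

Lemma nondec01_max p q : nondec01 p -> nondec01 q -> nondec01 (fun t => Num.max (p t) (q t)).
Proof.
move=> hp hq; have cp := nondec01_cont hp; have cq := nondec01_cont hq.
case: hp hq => [_ [pI pm]] [_ [qI qm]]; split; last split.
- by apply/continuous_I01P; prove_continuous.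
- by move=> t tI; have := pI _ tI; have := qI _ tI; case_minmax.
- move=> s t sI tI st; have := pm _ _ sI tI st; have := qm _ _ sI tI st; case_minmax; lra.
Qed.

Lemma nondec01_affine (a b : R) : 0 <= a -> I01 b -> a + b <= 1 -> nondec01 (fun t => a * t + b).
Proof.
move=> a0 /andP[b0 b1] ab; split; last split.
- by apply/continuous_I01P; prove_continuous.
- by move=> t /andP[t0 t1]; apply/andP; split; nra.
- by move=> s t _ _ st; nra.
Qed.

(** Runs through [[0,1]] during the first half and then waits at 1; the next map waits at 0 first.
    Together they describe the two branches of [concat] by maps defined on all of [[0,1]]. *)
Lemma nondec01_min_double : nondec01 (fun t : R => Num.min (2 * t) 1).
Proof.
split; last split.
- by apply/continuous_I01P; prove_continuous.
- by move=> t /andP[? ?]; apply/andP; split; case_minmax; lra.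
- by move=> s t _ _ st; case_minmax; lra.
Qed.

Lemma nondec01_max_double : nondec01 (fun t : R => Num.max (2 * t - 1) 0).
Proof.
split; last split.
- by apply/continuous_I01P; prove_continuous.
- by move=> t /andP[? ?]; apply/andP; split; case_minmax; lra.
- by move=> s t _ _ st; case_minmax; lra.
Qed.

(* Along an increasing [v], the segment from [p] to [p'] is swept monotonically because [p <= p']. *)
Lemma nondec01_interp p p' u v : nondec01 p -> nondec01 p' -> nondec01 u -> nondec01 v ->
  (forall t, I01 t -> p t <= p' t) ->
  nondec01 (fun t => (1 - v t) * p (u t) + v t * p' (u t)).
Proof.
move=> hp hp' hu hv pp'.
have c1 := nondec01_cont (nondec01_comp hp hu).
have c2 := nondec01_cont (nondec01_comp hp' hu).
have c3 := nondec01_cont hv.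
case: hp hp' hu hv => [_ [pI pm]] [_ [pI' pm']] [_ [uI um]] [_ [vI vm]].
split; last split.
- by apply/continuous_I01P; prove_continuous.
- move=> t tI; have /andP[? ?] := pI _ (uI _ tI); have /andP[? ?] := pI' _ (uI _ tI).
  by have /andP[? ?] := vI _ tI; apply/andP; split; nra.
- move=> s t sI tI st.
  have h1 := pm _ _ (uI _ sI) (uI _ tI) (um _ _ sI tI st).
  have h2 := pm' _ _ (uI _ sI) (uI _ tI) (um _ _ sI tI st).
  have h3 := vm _ _ sI tI st; have h4 := pp' _ (uI _ sI).
  have /andP[? ?] := vI _ tI; rewrite -subr_ge0.
  (* All factors are nonnegative; the last product is the one that needs [p <= p']. *)
  rewrite (_ : _ - _ = (1 - v t) * (p (u t) - p (u s)) + v t * (p' (u t) - p' (u s))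
     + (v t - v s) * (p' (u s) - p (u s))); last by ring.
  by rewrite !addr_ge0 // mulr_ge0 // ?subr_ge0 //; lra.
Qed.

End Nondec.
#[export] Hint Resolve I01_0 I01_1 : core.

(** * Directed homotopies and the laws of concatenation *)

Section Paths.
Variables (R : realType) (X : dspace R).
Implicit Types (Y : set X) (g h : R -> X).

Definition path_from_to Y (a b : X) g := dipath_in Y g /\ g 0 = a /\ g 1 = b.

Lemma dipath_in_path Y g : dipath_in Y g -> path_from_to Y (g 0) (g 1) g.
Proof. by []. Qed.

Lemma dipath_in_ext Y g g' : dipath_in Y g -> (forall t, I01 t -> g t = g' t) -> dipath_in Y g'.
Proof. by case=> dg Yg e; split; [exact: dipath_ext dg e|move=> t tI; rewrite -e //; exact: Yg]. Qed.

Lemma dipath_in_reparam Y g p : dipath_in Y g -> nondec01 p -> dipath_in Y (fun t => g (p t)).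
Proof.
case=> dg Yg hp; split; first exact: (dipath_reparam dg hp).
by case: hp => _ [pI _] t /pI /Yg.
Qed.

Lemma dipath_in_sub Y Y' g : Y `<=` Y' -> dipath_in Y g -> dipath_in Y' g.
Proof. by move=> YY' [dg Yg]; split=> // t /Yg /YY'. Qed.

Lemma dipath_in_cst Y (a : X) : Y a -> dipath_in Y (fun _ => a).
Proof. by move=> Ya; split=> //; exact: dipath_const. Qed.

Lemma concat0 g h : concat g h 0 = g 0.
Proof. by rewrite /concat ifT ?mulr0 //; lra. Qed.
Lemma concat1 g h : concat g h 1 = h 1.
Proof. by rewrite /concat ifF; [congr (h _); lra|lra]. Qed.

Lemma path_concat Y a b c g h : path_from_to Y a b g -> path_from_to Y b c h ->
  path_from_to Y a c (concat g h).
Proof.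
case=> [[dg Yg] [g0 g1]] [[dh Yh] [h0 h1]]; split; last by rewrite concat0 concat1.
split; first by apply: dipath_concat => //; rewrite g1 h0.
move=> t /andP[t0 t1]; rewrite /concat; case: ifP => ht.
- by apply: Yg; apply/andP; split; lra.
- by apply: Yh; apply/andP; split; lra.
Qed.

Lemma concat_ext g h g' h' : (forall t, I01 t -> g t = g' t) -> (forall t, I01 t -> h t = h' t) ->
  forall t, I01 t -> concat g h t = concat g' h' t.
Proof.
move=> eg eh t /andP[t0 t1]; rewrite /concat; case: ifP => ht.
- by apply: eg; apply/andP; split; lra.
- by apply: eh; apply/andP; split; lra.
Qed.

Lemma dimap_sq_dipath Y H p q : dimap_sq Y H -> nondec01 p -> nondec01 q ->
  dipath_in Y (fun t => H (p t, q t)).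
Proof. by case=> _; exact. Qed.

Lemma dimap_sq_path Y g : dipath_in Y g -> dimap_sq Y (fun ts => g ts.1).
Proof.
move=> dg; split; last by move=> p q hp _; exact: dipath_in_reparam.
apply/continuous_IsqP; rewrite /clamp2 /=.
have /continuous_I01P c := dipath_cont (proj1 dg).
exact: (comp_continuous (@fst_continuous R R) c).
Qed.

Lemma nondec01_I01 (p : R -> R) t : nondec01 p -> I01 t -> I01 (p t).
Proof. by case=> _ [h _] /h. Qed.

Lemma dimap_sq_prod Y H p q : dimap_sq Y H -> nondec01 p -> nondec01 q ->
  dimap_sq Y (fun ts => H (p ts.1, q ts.2)).
Proof.
move=> [cH dH] hp hq; split; last first.
  by move=> u v hu hv; apply: (dH (fun t => p (u t)) (fun t => q (v t)));
    exact: nondec01_comp.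
apply/continuous_IsqP; rewrite /clamp2 /=.
rewrite (_ : (fun t => _) =
  (fun t => (fun u => H (clamp2 u)) (p (clamp t.1), q (clamp t.2)))); last first.
  apply/funext => t; rewrite /clamp2 /=.
  by rewrite ![clamp (_ (clamp _))]clamp_id //; apply: nondec01_I01 => //; exact: I01_clamp.
apply: (@comp_continuous _ _ _ (fun t : R * R => (p (clamp t.1), q (clamp t.2)))
  (fun u => H (clamp2 u))); last exact/continuous_IsqP.
apply: pair_continuous.
- exact: (comp_continuous (@fst_continuous R R) (nondec01_cont hp)).
- exact: (comp_continuous (@snd_continuous R R) (nondec01_cont hq)).
Qed.

(** The straight-line homotopy between two monotone paths stays in the square by convexity; it is
    directed because the first path lies below the second in both coordinates. *)
Lemma dimap_sq_straight_line Y H p q p' q' : dimap_sq Y H ->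
  nondec01 p -> nondec01 q -> nondec01 p' -> nondec01 q' ->
  (forall t, I01 t -> p t <= p' t) -> (forall t, I01 t -> q t <= q' t) ->
  p 0 = p' 0 -> q 0 = q' 0 -> p 1 = p' 1 -> q 1 = q' 1 ->
  dhtpy Y (H (p 0, q 0)) (H (p 1, q 1)) (fun t => H (p t, q t)) (fun t => H (p' t, q' t)).
Proof.
move=> [cH dH] hp hq hp' hq' pp' qq' p0 q0 p1 q1.
pose P ts := (1 - ts.2) * p ts.1 + ts.2 * p' ts.1.
pose Q ts := (1 - ts.2) * q ts.1 + ts.2 * q' ts.1.
have I01P ts : I01 ts.1 -> I01 ts.2 -> I01 (P ts) /\ I01 (Q ts).
  case: ts => t s /= tI sI; have := nondec01_I01 hp tI; have := nondec01_I01 hp' tI.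
  have := nondec01_I01 hq tI; have := nondec01_I01 hq' tI; case/andP: sI => ? ?.
  move=> /andP[? ?] /andP[? ?] /andP[? ?] /andP[? ?].
  by rewrite /P /Q /=; split; apply/andP; split; nra.
exists (fun ts => H (P ts, Q ts)); split; last split; last split.
- split; last by move=> u v hu hv; apply: dH; exact: nondec01_interp.
  apply/continuous_IsqP.
  rewrite (_ : (fun t => _) =
    (fun t => (fun u => H (clamp2 u)) (P (clamp2 t), Q (clamp2 t)))); last first.
    apply/funext => t; rewrite [clamp2 (P _, Q _)]/clamp2 /=.
    have [] := @I01P (clamp2 t); try exact: I01_clamp.
    by move=> h1 h2; rewrite !clamp_id.
  apply: (@comp_continuous _ _ _ (fun t => (P (clamp2 t), Q (clamp2 t)))
    (fun u => H (clamp2 u))); last exact/continuous_IsqP.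
  have c1 (r : R -> R) : nondec01 r -> continuous (fun t : R * R => r (clamp t.1)).
    by move=> hr; exact: (comp_continuous (@fst_continuous R R) (nondec01_cont hr)).
  rewrite /P /Q /clamp2 /=; have c2 := c1 _ hp; have c3 := c1 _ hp'.
  by have c4 := c1 _ hq; have c5 := c1 _ hq'; prove_continuous.
- by move=> t _; rewrite /P /Q /= subr0 !mul1r !mul0r !addr0.
- by move=> t _; rewrite /P /Q /= subrr !mul1r !mul0r !add0r.
- move=> s _; rewrite /P /Q /= -p0 -q0 -p1 -q1.
  by split; congr (H (_, _)); ring.
Qed.

(** Values outside [[0,1]] are arbitrary, so functions describing the same path may differ; a
    constant homotopy identifies them. *)
Lemma dhtpy_ext Y g g' : dipath_in Y g -> (forall t, I01 t -> g t = g' t) ->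
  dhtpy Y (g 0) (g 1) g g'.
Proof.
by move=> dg e; exists (fun ts => g ts.1); split; [exact: dimap_sq_path|split; [|split]].
Qed.

Lemma dihom_ext Y a b g g' : path_from_to Y a b g -> (forall t, I01 t -> g t = g' t) ->
  dihom Y a b g g'.
Proof. by case=> dg [<- <-] e; apply: rst_step; exact: dhtpy_ext. Qed.

(** No directed straight line joins [p] to [q] unless they are comparable, so both are joined to
    their maximum. *)
Lemma dihom_reparam Y a b g (p q : R -> R) : path_from_to Y a b g ->
  nondec01 p -> nondec01 q -> p 0 = 0 -> p 1 = 1 -> q 0 = 0 -> q 1 = 1 ->
  dihom Y a b (fun t => g (p t)) (fun t => g (q t)).
Proof.
case=> dg [g0 g1] hp hq p0 p1 q0 q1.
have to_max (r : R -> R) : nondec01 r -> (forall t, r t <= Num.max (p t) (q t)) ->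
    r 0 = 0 -> r 1 = 1 ->
    dihom Y a b (fun t => g (r t)) (fun t => g (Num.max (p t) (q t))).
  move=> hr rle r0 r1; apply: rst_step; rewrite -g0 -g1.
  have := @dimap_sq_straight_line Y (fun ts => g ts.1) r r
    (fun t => Num.max (p t) (q t)) r; rewrite /= r0 r1; apply=> //.
  - exact: dimap_sq_path.
  - exact: nondec01_max.
  - by rewrite p0 q0 maxxx.
  - by rewrite p1 q1 maxxx.
apply: rst_trans; [apply: (to_max p)|apply: rst_sym; apply: (to_max q)] => //.
- by move=> t; case_minmax; lra.
- by move=> t; case_minmax; lra.
Qed.

Lemma dihom_of_reparam Y a b g g' (p : R -> R) : path_from_to Y a b g ->
  nondec01 p -> p 0 = 0 -> p 1 = 1 -> (forall t, I01 t -> g (p t) = g' t) ->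
  dihom Y a b g g'.
Proof.
move=> pg hp p0 p1 e; apply: (rst_trans _ _ _ (fun t => g (p t))).
- by apply: (@dihom_reparam Y a b g (fun t => t)) => //; exact: nondec01_id.
- case: pg => dg [g0 g1]; apply: dihom_ext => //; split; last by rewrite p0 p1.
  exact: dipath_in_reparam.
Qed.

Lemma path_dihom Y a b g g' : path_from_to Y a b g -> dihom Y a b g g' ->
  path_from_to Y a b g'.
Proof.
(* An equivalence is proved so that the induction passes through the symmetric closure. *)
move=> pg hd; suff : path_from_to Y a b g <-> path_from_to Y a b g' by case=> /(_ pg).
elim: hd => {g g' pg} [g g'|//|g g' _ [h1 h2]|g1 g2 g3 _ [h1 h2] _ [h3 h4]]; last 2 first.
- by split.
- by split=> [/h1/h3|/h4/h2].
case=> H [[cH dH] [H0 [H1 Hs]]].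
have e s : I01 s -> path_from_to Y a b (fun t => H (t, s)).
  move=> sI; split; last by case: (Hs _ sI).
  by apply: (dH (fun t => t) (fun=> s)); [exact: nondec01_id|exact: nondec01_cst].
have eg s (k : R -> X) : I01 s -> (forall t, I01 t -> H (t, s) = k t) -> path_from_to Y a b k.
  move=> sI ek; have [dk [k0 k1]] := e _ sI.
  by split; [exact: dipath_in_ext dk ek|rewrite -!ek].
by split=> _; [apply: (eg 1)|apply: (eg 0)].
Qed.

Lemma dihom_sub Y Y' a b g g' : Y `<=` Y' -> dihom Y a b g g' -> dihom Y' a b g g'.
Proof.
move=> YY'; elim=> {g g'} [g g' [H [[cH dH] hH]]|g|g g' _|g1 g2 g3 _ h1 _ h2].
- apply: rst_step; exists H; split=> //; split=> // p q hp hq.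
  exact: dipath_in_sub (dH _ _ hp hq).
- exact: rst_refl.
- exact: rst_sym.
- exact: rst_trans h1 h2.
Qed.


(* A function that is a dipath on both sides of [t0] is, up to reparametrization, a concatenation. *)
Lemma dipath_in_glue Y g (t0 : R) : 0 < t0 < 1 ->
  dipath_in Y (fun t => g (t0 * t)) -> dipath_in Y (fun t => g ((1 - t0) * t + t0)) ->
  dipath_in Y g.
Proof.
move=> /andP[t0_gt0 t0_lt1] d1 d2.
have n1 : t0 != 0 by rewrite gt_eqF.
have n2 : 1 - t0 != 0 by rewrite gt_eqF // subr_gt0.
(* Piecewise linear with [t0] sent to 1/2: the first summand stops growing at [t0], the second
   starts there. *)
pose r t := Num.min (2^-1 * (t / t0)) (2^-1) + Num.max (2^-1 * ((t - t0) / (1 - t0))) 0.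
have hr : nondec01 r.
  split; last split.
  - by apply/continuous_I01P; rewrite /r; prove_continuous.
  - move=> t /andP[? ?]; have h1 : 0 <= t / t0 by rewrite divr_ge0 // ltW.
    have h2 : (t - t0) / (1 - t0) <= 1 by rewrite ler_pdivrMr ?subr_gt0 // mul1r; lra.
    by rewrite /r; apply/andP; split; case_minmax; lra.
  - move=> s t _ _ st; have h1 : s / t0 <= t / t0 by rewrite ler_pM2r // invr_gt0.
    have h2 : (s - t0) / (1 - t0) <= (t - t0) / (1 - t0).
      by rewrite ler_pM2r ?invr_gt0 ?subr_gt0 // lerD2r.
    by rewrite /r; case_minmax; lra.
have [dc _] : path_from_to Y (g (t0 * 0)) (g ((1 - t0) * 1 + t0))
    (concat (fun t => g (t0 * t)) (fun t => g ((1 - t0) * t + t0))).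
  apply: path_concat (dipath_in_path d1) _; split=> //; split=> //.
  by congr g; ring.
apply: dipath_in_ext (dipath_in_reparam dc hr) _ => t /andP[t_ge0 t_le1].
rewrite /concat /r; case: (leP t t0) => tt0.
  have h1 : t / t0 <= 1 by rewrite ler_pdivrMr // mul1r.
  have h2 : (t - t0) / (1 - t0) <= 0 by rewrite pmulr_lle0 ?invr_gt0 ?subr_gt0 // subr_le0.
  rewrite min_l; last lra.
  rewrite max_r; last lra.
  rewrite ifT; last lra.
  by congr g; field.
have h1 : 1 < t / t0 by rewrite ltr_pdivlMr // mul1r.
have h2 : 0 < (t - t0) / (1 - t0) by rewrite divr_gt0 ?subr_gt0.
rewrite min_r; last lra.
rewrite max_l; last lra.
rewrite ifF; last lra.
by congr g; field.
Qed.

(** The difficulty is a dipath of the square that crosses the seam between the two halves. Its first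
    coordinate is non-decreasing, so it can be cut at a time [t0], given by the intermediate value
    theorem, into one piece on each side; [dipath_in_glue] reassembles them. *)
Lemma dimap_sq_concat Y H1 H2 : dimap_sq Y H1 -> dimap_sq Y H2 ->
  (forall s, I01 s -> H1 (1, s) = H2 (0, s)) ->
  dimap_sq Y (fun ts => concat (fun t => H1 (t, ts.2)) (fun t => H2 (t, ts.2)) ts.1).
Proof.
move=> dm1 dm2 e; set K := fun ts => _.
(* [2 * p t] may leave [[0,1]]; its truncation does not, and has the same values where [p t <= 1/2].
   Likewise on the other side. *)
have hl (p : R -> R) (hp : nondec01 p) := nondec01_comp (nondec01_min_double R) hp.
have hr (p : R -> R) (hp : nondec01 p) := nondec01_comp (nondec01_max_double R) hp.
have lhalf p q : nondec01 p -> nondec01 q -> (forall t, I01 t -> p t <= 2^-1) ->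
    dipath_in Y (fun t => K (p t, q t)).
  move=> hp hq ple; apply: dipath_in_ext (dimap_sq_dipath dm1 (hl _ hp) hq) _ => t tI /=.
  have := ple _ tI; rewrite /K /concat /= => h; rewrite h min_l //; lra.
have rhalf p q : nondec01 p -> nondec01 q -> (forall t, I01 t -> 2^-1 <= p t) ->
    dipath_in Y (fun t => K (p t, q t)).
  move=> hp hq ple; apply: dipath_in_ext (dimap_sq_dipath dm2 (hr _ hp) hq) _ => t tI /=.
  have := ple _ tI; rewrite /K /concat /= => h; rewrite max_l; last lra.
  (* On the seam [concat] takes its left branch, which [e] identifies with the right one. *)
  case: ifP => // h'; have -> : p t = 2^-1 by lra.
  by rewrite mulfV ?pnatr_eq0 // subrr e //; exact: nondec01_I01.
split.
  apply/continuous_IsqP; rewrite /K /clamp2 /concat /=.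
  have c0 : continuous (fun t : R * R => clamp t.1).
    exact: comp_continuous (@fst_continuous R R) (@clamp_continuous R).
  have c1 : continuous (fun t : R * R => H1 (clamp (2 * clamp t.1), clamp t.2)).
    have /continuous_IsqP c := proj1 dm1.
    apply: (@comp_continuous _ _ _ (fun t : R * R => (2 * clamp t.1, t.2))
      (fun u => H1 (clamp2 u))) => //.
    by prove_continuous.
  have c2 : continuous (fun t : R * R => H2 (clamp (2 * clamp t.1 - 1), clamp t.2)).
    have /continuous_IsqP c := proj1 dm2.
    apply: (@comp_continuous _ _ _ (fun t : R * R => (2 * clamp t.1 - 1, t.2))
      (fun u => H2 (clamp2 u))) => //.
    by prove_continuous.
  have := continuous_if c0 c1 c2 (r := 2^-1).
  have E : (fun x : R * R => if clamp x.1 <= 2^-1 then H1 (clamp (2 * clamp x.1), clamp x.2)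
      else H2 (clamp (2 * clamp x.1 - 1), clamp x.2)) =
    (fun t : R * R => if clamp t.1 <= 2^-1 then H1 (2 * clamp t.1, clamp t.2)
      else H2 (2 * clamp t.1 - 1, clamp t.2)).
    apply/funext => x; have /andP[? ?] := I01_clamp x.1.
    by case: ifP => h; [rewrite [clamp (2 * _)]clamp_id //|rewrite [clamp (2 * _ - 1)]clamp_id //];
      apply/andP; split; lra.
  rewrite E; apply=> x ->; rewrite mulfV ?pnatr_eq0 // subrr [clamp 1]clamp_id // [clamp 0]clamp_id //.
  by apply: e; exact: I01_clamp.
move=> p q hp hq; have [pc [pI pm]] := hp.
case: (leP (2^-1) (p 0)) => [p0|p0].
  apply: rhalf => // t tI; apply: le_trans p0 (pm _ _ _ tI _) => //; by case/andP: tI.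
case: (leP (p 1) (2^-1)) => [p1|p1].
  apply: lhalf => // t tI; apply: le_trans (pm _ _ tI _ _) p1 => //; by case/andP: tI.
have [t0 t0I pt0] : exists2 t0, t0 \in `[0, 1] & p t0 = 2^-1.
  apply: IVT; first exact: ler01.
    have -> // : `[0, 1]%classic = @I01 R.
    by apply/seteqP; split=> t; rewrite /= in_itv.
  by rewrite min_l ?max_r; [apply/andP; split; lra|lra|lra].
have {}t0I : I01 t0 by move: t0I; rewrite in_itv.
have t0_gt0 : 0 < t0.
  rewrite lt_neqAle; case/andP: t0I => -> _; rewrite andbT.
  by apply/eqP => h; move: p0; rewrite h pt0 ltxx.
have t0_lt1 : t0 < 1.
  rewrite lt_neqAle; case/andP: t0I => _ ->; rewrite andbT.
  by apply/eqP => h; move: p1; rewrite (_ : p 1 = 2^-1) ?ltxx // -pt0 h.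
have na1 : nondec01 (fun t => t0 * t).
  rewrite (_ : (fun t => _) = fun t => t0 * t + 0); last by apply/funext => t; rewrite addr0.
  by apply: nondec01_affine => //; lra.
have na2 : nondec01 (fun t => (1 - t0) * t + t0) by apply: nondec01_affine => //; lra.
apply: (dipath_in_glue (t0 := t0)); first by rewrite t0_gt0.
- apply: (lhalf (fun t => p (t0 * t)) (fun t => q (t0 * t))); try exact: (nondec01_comp _ na1).
  move=> t tI; rewrite -pt0; apply: pm => //; first exact: (nondec01_I01 na1).
  by case/andP: tI => ? ?; nra.
- apply: (rhalf (fun t => p ((1 - t0) * t + t0)) (fun t => q ((1 - t0) * t + t0)));
    try exact: (nondec01_comp _ na2).
  move=> t tI; rewrite -pt0; apply: pm => //; first exact: (nondec01_I01 na2).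
  by case/andP: tI => ? ?; nra.
Qed.

Lemma dhtpy_concat Y a b c g g' h h' : dhtpy Y a b g g' -> dhtpy Y b c h h' ->
  dhtpy Y a c (concat g h) (concat g' h').
Proof.
move=> [H [dH [H0 [H1 Hs]]]] [K [dK [K0 [K1 Ks]]]].
exists (fun ts => concat (fun t => H (t, ts.2)) (fun t => K (t, ts.2)) ts.1).
split; [|split; [|split]].
- by apply: dimap_sq_concat => // s sI; rewrite (Hs s sI).2 (Ks s sI).1.
- by move=> t tI /=; apply: concat_ext.
- by move=> t tI /=; apply: concat_ext.
- by move=> s sI /=; rewrite concat0 concat1 (Hs s sI).1 (Ks s sI).2.
Qed.

(** The two chains of elementary homotopies may differ in length and direction, so one factor is
    moved at a time while the other is kept under a constant homotopy. *)
Lemma dihom_concat Y a b c g g' h h' : path_from_to Y a b g -> path_from_to Y b c h ->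
  dihom Y a b g g' -> dihom Y b c h h' -> dihom Y a c (concat g h) (concat g' h').
Proof.
have refl x y k : path_from_to Y x y k -> dhtpy Y x y k k.
  by case=> dk [<- <-]; exact: dhtpy_ext.
move=> pg ph dg dh; apply: (rst_trans _ _ _ (concat g' h)).
- elim: dg => {g g' pg} [g g' s|g|g g' _|g1 g2 g3 _ h1 _ h2].
  + by apply: rst_step; apply: dhtpy_concat s _; exact: refl.
  + exact: rst_refl.
  + exact: rst_sym.
  + exact: rst_trans h1 h2.
- have pg' := path_dihom pg dg.
  elim: dh => {h h' ph} [h h' s|h|h h' _|h1 h2 h3 _ i1 _ i2].
  + by apply: rst_step; apply: dhtpy_concat s; exact: refl.
  + exact: rst_refl.
  + exact: rst_sym.
  + exact: rst_trans i1 i2.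
Qed.

Lemma dihom_concatA Y a b c d f g h : path_from_to Y a b f -> path_from_to Y b c g ->
  path_from_to Y c d h -> dihom Y a d (concat (concat f g) h) (concat f (concat g h)).
Proof.
move=> pf pg ph; apply: rst_sym.
(* The piecewise linear map sending 1/4 to 1/2 and 1/2 to 3/4. Its slopes 2, 1, 1/2 decrease, so it
   is the minimum of its three linear pieces. *)
apply: (dihom_of_reparam (p := fun t => Num.min (2 * t) (Num.min (t + 4^-1) (2^-1 * (t + 1))))).
- exact: path_concat pf (path_concat pg ph).
- split; last split.
  + by apply/continuous_I01P; prove_continuous.
  + by move=> t /andP[? ?]; apply/andP; split; case_minmax; lra.
  + by move=> s t _ _ st; case_minmax; lra.
- by case_minmax; lra.
- by case_minmax; lra.
move=> t /andP[t0 t1]; rewrite /concat.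
case: (leP t (2^-1)) => [h1|h1].
  case: (leP (2 * t) (2^-1)) => [h2|h2].
    rewrite min_l; last by case_minmax; lra.
    by rewrite ifT //; lra.
  rewrite min_r; last by case_minmax; lra.
  rewrite min_l; last lra.
  rewrite ifF; last lra.
  by rewrite ifT; [congr g; lra|lra].
rewrite min_r; last by case_minmax; lra.
rewrite min_r; last lra.
rewrite ifF; last lra.
by rewrite ifF; [congr h; lra|lra].
Qed.

Lemma dihom_cst_concat Y a b g : path_from_to Y a b g -> dihom Y a b g (concat (fun=> a) g).
Proof.
move=> pg; apply: (dihom_of_reparam (p := fun t => Num.max (2 * t - 1) 0) pg).
- exact: nondec01_max_double.
- by case_minmax; lra.
- by case_minmax; lra.
- move=> t /andP[? ?]; rewrite /concat; case: ifP => h.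
    by rewrite max_r ?pg.2.1 //; lra.
  by rewrite max_l //; lra.
Qed.

Lemma dihom_concat_cst Y a b g : path_from_to Y a b g -> dihom Y a b g (concat g (fun=> b)).
Proof.
move=> pg; apply: (dihom_of_reparam (p := fun t => Num.min (2 * t) 1) pg).
- exact: nondec01_min_double.
- by case_minmax; lra.
- by case_minmax; lra.
- move=> t /andP[? ?]; rewrite /concat; case: ifP => h.
    by rewrite min_l //; lra.
  by rewrite min_r ?pg.2.2 //; lra.
Qed.

(* Both boundary paths lie below the path that runs along the diagonal. *)
Lemma dihom_square Y H : dimap_sq Y H -> dihom Y (H (0, 0)) (H (1, 1))
  (concat (fun t => H (t, 0)) (fun s => H (1, s)))
  (concat (fun s => H (0, s)) (fun t => H (t, 1))).
Proof.
(* [(p, q)] runs along the bottom and then the right side, [(q, p)] along the left side and then the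
   top. *)
move=> dH; pose p (t : R) := Num.min (2 * t) 1; pose q (t : R) := Num.max (2 * t - 1) 0.
have hp : nondec01 p by exact: nondec01_min_double.
have hq : nondec01 q by exact: nondec01_max_double.
have p0 : p 0 = 0 by rewrite /p; case_minmax; lra.
have p1 : p 1 = 1 by rewrite /p; case_minmax; lra.
have q0 : q 0 = 0 by rewrite /q; case_minmax; lra.
have q1 : q 1 = 1 by rewrite /q; case_minmax; lra.
have pq t : I01 t -> q t <= p t by move=> /andP[? ?]; rewrite /p /q; case_minmax; lra.
rewrite (_ : concat _ _ = (fun t => H (p t, q t))); last first.
  apply/funext => t; rewrite /concat /p /q; case: ifP => h.
    by rewrite min_l ?max_r //; lra.
  by rewrite min_r ?max_l //; lra.
rewrite (_ : concat _ _ = (fun t => H (q t, p t))); last first.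
  apply/funext => t; rewrite /concat /p /q; case: ifP => h.
    by rewrite min_l ?max_r //; lra.
  by rewrite min_r ?max_l //; lra.
apply: (rst_trans _ _ _ (fun t => H (p t, p t))); [|apply: rst_sym]; apply: rst_step.
- have := dimap_sq_straight_line (p := p) (q := q) (p' := p) (q' := p) dH; rewrite p0 q0 p1 q1; exact.
- have := dimap_sq_straight_line (p := q) (q := p) (p' := p) (q' := p) dH; rewrite p0 q0 p1 q1; exact.
Qed.

End Paths.

(** * Arrows packed with their ends *)

Lemma existT_inj (T : Type) (P : T -> Type) (x : T) (u v : P x) :
  existT P x u = existT P x v -> u = v.
Proof.
by move=> e; have := projT2_eq e; rewrite (Prop_irrelevance (projT1_eq e) erefl).
Qed.

Section Arrows.
Variable E : PreCat.

(* [None] is an absorbing element standing for an undefined composite, so that composition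
   becomes a total associative operation. *)
Definition arrow := option {ab : Ob E * Ob E & Mor E ab.1 ab.2}.

Definition arr {a b : Ob E} (f : Mor E a b) : arrow :=
  Some (existT (fun ab : Ob E * Ob E => Mor E ab.1 ab.2) (a, b) f).

Definition acomp (u v : arrow) : arrow :=
  match u, v with
  | Some (existT (a, b) f), Some (existT (b', c) g) =>
    match pselect (b = b') with
    | left e => arr (comp f (eq_rect_r (fun x => Mor E x c) g e))
    | right _ => None
    end
  | _, _ => None
  end.

Lemma arrowP (u : arrow) : u = None \/ exists a b (f : Mor E a b), u = arr f.
Proof. by case: u => [[[a b] f]|]; [right; exists a, b, f|left]. Qed.

Lemma acomp_arr a b c (f : Mor E a b) (g : Mor E b c) :
  acomp (arr f) (arr g) = arr (comp f g).
Proof. by rewrite /= ; case: pselect => // e; rewrite (Prop_irrelevance e erefl). Qed.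

Lemma acomp_neq a b b' c (f : Mor E a b) (g : Mor E b' c) : b <> b' ->
  acomp (arr f) (arr g) = None.
Proof. by move=> n; rewrite /=; case: pselect. Qed.

Lemma arr_inj a b (f g : Mor E a b) : arr f = arr g -> f = g.
Proof.
move=> /Some_inj e.
exact: (@existT_inj _ (fun ab : Ob E * Ob E => Mor E ab.1 ab.2) (a, b) f g e).
Qed.

Lemma arr_ends a b a' b' (f : Mor E a b) (g : Mor E a' b') : arr f = arr g -> a = a' /\ b = b'.
Proof. by move=> /Some_inj e; case: (projT1_eq e). Qed.
End Arrows.
Arguments arr {E a b} f.

Lemma acompA (E : Category) (u v w : arrow E) :
  acomp (acomp u v) w = acomp u (acomp v w).
Proof.
case: (arrowP u) => [->|[a [b [f ->]]]] //.
case: (arrowP v) => [->|[b' [c [g ->]]]] //.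
case: (arrowP w) => [->|[c' [d [h ->]]]].
  by case: (acomp (arr f) (arr g)) => [[[? ?] ?]|].
have [e|n] := pselect (b = b'); last first.
  rewrite (acomp_neq _ _ n).
  have [e'|n'] := pselect (c = c'); last by rewrite (acomp_neq _ _ n').
  by rewrite -e' in h *; rewrite acomp_arr (acomp_neq _ _ n).
rewrite -e in g *; rewrite acomp_arr.
have [e'|n'] := pselect (c = c'); last by rewrite !(acomp_neq _ _ n').
by rewrite -e' in h *; rewrite !acomp_arr cat_assoc.
Qed.

(** An arrow records its ends, so agreement on identities already gives agreement on objects. *)
Lemma functor_eq (C E : PreCat) (F G : FunctorData C E) :
  (forall a b (f : Mor C a b), arr (fmor F f) = arr (fmor G f)) -> F = G.
Proof.
case: F G => Fo Fm [Go Gm] /= h.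
have e : Fo = Go.
  by apply/funext => a; case: (arr_ends (h a a (idm a))).
subst Go; congr Build_FunctorData.
apply: functional_extensionality_dep => a; apply: functional_extensionality_dep => b.
by apply/funext => f; exact/arr_inj/h.
Qed.

(** * Values of a functor on paths *)

Section Values.
Variables (R : realType) (X : dspace R).
Implicit Types (Y A : set X) (g h : R -> X).

Definition dipath_between Y A g := [/\ dipath_in Y g, A (g 0) & A (g 1)].

Lemma class_morph Y g : dipath_in Y g -> is_morph Y (g 0) (g 1) (dclass Y (g 0) (g 1) g).
Proof. by move=> dg; exists g. Qed.

Definition path_class Y A (hAY : A `<=` Y) g (hg : dipath_between Y A g) :
  Mor (pi hAY) (exist _ (g 0) (let: And3 _ h _ := hg in h)) (exist _ (g 1) (let: And3 _ _ h := hg in h)) :=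
  exist _ (dclass Y (g 0) (g 1) g) (class_morph (let: And3 h _ _ := hg in h)).

(** Defined on paths, so that values are compared by plain equalities in [arrow E], with no
    transport along equalities of end points. *)
Definition path_val {Y A : set X} {hAY : A `<=` Y} {E} (F : FunctorData (pi hAY) E) g : arrow E :=
  match pselect (dipath_between Y A g) with
  | left hg => arr (fmor F (path_class hAY hg))
  | right _ => None
  end.

Lemma class_path Y A (hAY : A `<=` Y) (a b : Ob (pi hAY)) (f : Mor (pi hAY) a b) g :
  sval f g -> path_from_to Y (sval a) (sval b) g.
Proof.
case: (svalP f) => g0 [d0 [e0 [e1 ->]]] [dg hd].
exact: path_dihom hd.
Qed.

Lemma class_of_path Y A (hAY : A `<=` Y) (a b : Ob (pi hAY)) (f : Mor (pi hAY) a b) g :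
  sval f g -> sval f = dclass Y (sval a) (sval b) g.
Proof.
case: (svalP f) => g0 [d0 [e0 [e1 ->]]] [dg hd].
apply/seteqP; split=> k [dk hk]; split=> //.
- by apply: rst_trans hk; exact: rst_sym.
- exact: rst_trans hk.
Qed.

Lemma mor_eq Y A (hAY : A `<=` Y) (a b : Ob (pi hAY)) (f f' : Mor (pi hAY) a b) g :
  sval f g -> sval f' g -> f = f'.
Proof.
move=> h h'; have := class_of_path h; rewrite -(class_of_path h').
case: f f' h h' => [C hC] [C' hC'] /= _ _ e; subst C'.
by rewrite (Prop_irrelevance hC hC').
Qed.

Lemma rep_in Y A (hAY : A `<=` Y) (a b : Ob (pi hAY)) (f : Mor (pi hAY) a b) : sval f (rep f).
Proof.
rewrite /rep; case: ClassicalEpsilon.constructive_indefinite_description => g /= [dg [g0 [g1 ->]]].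
by split=> //; exact: rst_refl.
Qed.

Lemma rep_path Y A (hAY : A `<=` Y) (a b : Ob (pi hAY)) (f : Mor (pi hAY) a b) :
  path_from_to Y (sval a) (sval b) (rep f).
Proof. exact: class_path (rep_in f). Qed.

Lemma rep_dihom Y A (hAY : A `<=` Y) (a b : Ob (pi hAY)) (f : Mor (pi hAY) a b) g :
  sval f g -> dihom Y (sval a) (sval b) (rep f) g.
Proof. by rewrite (class_of_path (rep_in f)) => -[]. Qed.

Lemma path_class_in Y A (hAY : A `<=` Y) g (hg : dipath_between Y A g) :
  sval (path_class hAY hg) g.
Proof. by split; [case: hg|exact: rst_refl]. Qed.

Lemma sig_eq (T : Type) (A : set T) (a b : {x | A x}) : sval a = sval b -> a = b.
Proof. by case: a b => [a ha] [b hb] /= e; subst b; rewrite (Prop_irrelevance ha hb). Qed.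

Lemma path_val_class Y A (hAY : A `<=` Y) E (F : FunctorData (pi hAY) E)
    (a b : Ob (pi hAY)) (f : Mor (pi hAY) a b) g :
  sval f g -> path_val F g = arr (fmor F f).
Proof.
move=> fg; have [dg [g0 g1]] := class_path fg.
have hg : dipath_between Y A g.
  by split=> //; [rewrite g0; exact: (svalP a)|rewrite g1; exact: (svalP b)].
rewrite /path_val; case: pselect => // {}hg.
move: (path_class_in hAY hg); move: (path_class hAY hg).
set a' := exist _ (g 0) _; set b' := exist _ (g 1) _.
have ea : a' = a by exact: sig_eq.
have eb : b' = b by exact: sig_eq.
rewrite ea eb => f' f'g; congr (arr (fmor F _)); exact: mor_eq f'g fg.
Qed.

Lemma mor_of_path Y A (hAY : A `<=` Y) (a b : Ob (pi hAY)) g :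
  path_from_to Y (sval a) (sval b) g -> exists f : Mor (pi hAY) a b, sval f g.
Proof.
case=> dg [g0 g1].
have h : is_morph Y (sval a) (sval b) (dclass Y (sval a) (sval b) g) by exists g.
by exists (exist _ _ h); split=> //; exact: rst_refl.
Qed.

Lemma path_mor Y A (hAY : A `<=` Y) g : dipath_between Y A g ->
  exists (a b : Ob (pi hAY)) (f : Mor (pi hAY) a b),
   [/\ sval f g, sval a = g 0 & sval b = g 1].
Proof.
move=> hg; exists (exist _ (g 0) (let: And3 _ h _ := hg in h)),
  (exist _ (g 1) (let: And3 _ _ h := hg in h)), (path_class hAY hg).
by split=> //; exact: path_class_in.
Qed.

Lemma idm_in Y A (hAY : A `<=` Y) (a : Ob (pi hAY)) : sval (idm a) (fun=> sval a).
Proof.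
by split; [apply: dipath_in_cst; exact: (hAY _ (svalP a))|exact: rst_refl].
Qed.

(** Frees composition from the chosen representatives [rep]: any members of the two classes may be
    concatenated. *)
Lemma comp_in Y A (hAY : A `<=` Y) (a b c : Ob (pi hAY)) (f : Mor (pi hAY) a b)
    (f' : Mor (pi hAY) b c) g h :
  sval f g -> sval f' h -> sval (comp f f') (concat g h).
Proof.
move=> fg fh; have pg := class_path fg; have ph := class_path fh.
have pr := rep_path f; have pr' := rep_path f'.
split; first by case: (path_concat pg ph).
exact: (dihom_concat pr pr' (rep_dihom fg) (rep_dihom fh)).
Qed.

Lemma incl_in Y Y' A A' (hAY : A `<=` Y) (hAY' : A' `<=` Y') (hY : Y `<=` Y') (hA : A `<=` A')
    (a b : Ob (pi hAY)) (f : Mor (pi hAY) a b) g :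
  sval f g -> sval (fmor (incl hAY hAY' hY hA) f) g.
Proof.
move=> fg; have [dg _] := class_path fg; split; first exact: dipath_in_sub dg.
exact: dihom_sub (rep_dihom fg).
Qed.

Lemma path_val_incl Y Y' A A' (hAY : A `<=` Y) (hAY' : A' `<=` Y') (hY : Y `<=` Y') (hA : A `<=` A')
    E (F : FunctorData (pi hAY') E) g : dipath_between Y A g ->
  path_val F g = path_val (fcomp (incl hAY hAY' hY hA) F) g.
Proof.
case/(path_mor hAY) => [a [b [f [fg _ _]]]].
rewrite (path_val_class (fcomp _ F) fg); exact: (path_val_class F (incl_in hAY' hY hA fg)).
Qed.

Lemma path_val_dihom Y A (hAY : A `<=` Y) E (F : FunctorData (pi hAY) E) g g' :
  dipath_between Y A g -> dihom Y (g 0) (g 1) g g' -> path_val F g = path_val F g'.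
Proof.
move=> hg hd; have [a [b [f [fg ea eb]]]] := path_mor hAY hg.
rewrite (path_val_class F fg) (@path_val_class _ _ _ _ F _ _ f g') //.
rewrite (class_of_path fg) ea eb; split=> //.
by case: hg => dg _ _; case: (path_dihom (dipath_in_path dg) hd).
Qed.

Lemma path_val_concat Y A (hAY : A `<=` Y) E (F : FunctorData (pi hAY) E) g h : is_functor F ->
  dipath_between Y A g -> dipath_between Y A h -> g 1 = h 0 ->
  path_val F (concat g h) = acomp (path_val F g) (path_val F h).
Proof.
move=> [_ Fc] hg hh e; have [a [b [f [fg ea eb]]]] := path_mor hAY hg.
have [b' [c [f' [fh eb' ec]]]] := path_mor hAY hh.
have E' : b' = b by apply: sig_eq; rewrite eb' eb.
subst b'; rewrite (path_val_class F (comp_in fg fh)) (path_val_class F fg) (path_val_class F fh).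
by rewrite acomp_arr Fc.
Qed.

Lemma path_val_cst Y A (hAY : A `<=` Y) E (F : FunctorData (pi hAY) E) (a : Ob (pi hAY)) :
  is_functor F -> path_val F (fun=> sval a) = arr (idm (fob F a)).
Proof. by case=> Fi _; rewrite (path_val_class F (idm_in a)) Fi. Qed.

End Values.

(** * Dyadic bisection *)

Section Bisect.
Variable R : realType.

Definition bisect (i : bool) (t : R) : R := 2^-1 * t + (if i then 2^-1 else 0).

Lemma nondec01_bisect i : nondec01 (bisect i).
Proof. by apply: nondec01_affine; [lra|case: i; apply/andP; split; lra|case: i; lra]. Qed.

Lemma bisect00 : bisect false 0 = 0. Proof. by rewrite /bisect; lra. Qed.
Lemma bisect11 : bisect true 1 = 1. Proof. by rewrite /bisect; lra. Qed.
Lemma bisect01 : bisect false 1 = bisect true 0. Proof. by rewrite /bisect; lra. Qed.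

Lemma I01_bisect i t : I01 t -> I01 (bisect i t).
Proof. exact: (nondec01_I01 (nondec01_bisect i)). Qed.

(** An equality of functions, not only a homotopy: cutting a path in half costs no
    reparametrization. *)
Lemma concat_bisect (T : Type) (g : R -> T) :
  concat (fun t => g (bisect false t)) (fun t => g (bisect true t)) = g.
Proof. by apply/funext => t; rewrite /concat /bisect; case: ifP => _; congr g; lra. Qed.

End Bisect.
Arguments nondec01_bisect {R} i.
Arguments bisect00 {R}.
Arguments bisect11 {R}.
Arguments bisect01 {R}.

(** * Extending values of small dipaths to all dipaths *)

Section LocalToGlobal.
Variables (R : realType) (X : dspace R) (E : Category) (U : set (set X)).
Variable phi : (R -> X) -> arrow E.
Implicit Types (Y : set X) (g h : R -> X).

(** The object attached to a point is encoded by its identity arrow, the value of the constant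
    path. *)
Definition has_ends (m : arrow E) (x y : X) := exists a b (f : Mor E a b),
  [/\ phi (fun=> x) = arr (idm a), phi (fun=> y) = arr (idm b) & m = arr f].

Hypothesis Ucover : forall x : X, exists2 Y, U Y & nbhs x Y.
Hypothesis phi_dihom : forall Y g g', U Y -> dipath_in Y g ->
  dihom Y (g 0) (g 1) g g' -> phi g = phi g'.
Hypothesis phi_concat : forall Y g h, U Y -> dipath_in Y g -> dipath_in Y h -> g 1 = h 0 ->
  phi (concat g h) = acomp (phi g) (phi h).
Hypothesis phi_ends : forall Y g, U Y -> dipath_in Y g -> has_ends (phi g) (g 0) (g 1).

Fixpoint fine_path n g : Prop := if n is n'.+1
  then forall i, fine_path n' (fun t => g (bisect i t))
  else exists2 Y, U Y & dipath_in Y g.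

Fixpoint Phi n g : arrow E := if n is n'.+1
  then acomp (Phi n' (fun t => g (bisect false t))) (Phi n' (fun t => g (bisect true t)))
  else phi g.

Fixpoint fine_sq n (H : R * R -> X) : Prop := if n is n'.+1
  then forall i j, fine_sq n' (fun ts => H (bisect i ts.1, bisect j ts.2))
  else exists2 Y, U Y & dimap_sq Y H.

Lemma fine_ext n g g' : fine_path n g -> (forall t, I01 t -> g t = g' t) ->
  fine_path n g' /\ Phi n g = Phi n g'.
Proof.
elim: n g g' => [|n IH] g g' /=.
  move=> [Y UY dg] e; split; first by exists Y => //; exact: dipath_in_ext e.
  by apply: (phi_dihom UY dg); apply: dihom_ext.
move=> hf e; have h i := IH _ (fun t => g' (bisect i t)) (hf i) (fun t tI => e _ (I01_bisect i tI)).
by split; [move=> i; case: (h i)|rewrite (h false).2 (h true).2].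
Qed.

(** At a leaf, a small path is replaced by its two halves, and [phi_concat] says that their values
    compose to the old one. *)
Lemma fineS n g : fine_path n g -> fine_path n.+1 g /\ Phi n.+1 g = Phi n g.
Proof.
elim: n g => [|n IH] g hf.
  case: hf => Y UY dg.
  have d i : dipath_in Y (fun t => g (bisect i t)).
    exact: (dipath_in_reparam dg (nondec01_bisect i)).
  split; first by move=> i; exists Y.
  by rewrite /= -(phi_concat UY (d false) (d true)) ?bisect01 // concat_bisect.
split; first by move=> i; apply: (proj1 (IH _ (hf i))).
rewrite -[LHS]/(acomp (Phi n.+1 (fun t => g (bisect false t))) (Phi n.+1 (fun t => g (bisect true t)))).
by rewrite (IH _ (hf false)).2 (IH _ (hf true)).2.
Qed.

Lemma fine_add n m g : fine_path n g -> fine_path (m + n) g /\ Phi (m + n) g = Phi n g.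
Proof.
move=> hf; elim: m => [|m [h1 h2]] //.
by rewrite addSn; have [? ->] := fineS h1.
Qed.

Lemma Phi_indep n m g : fine_path n g -> fine_path m g -> Phi n g = Phi m g.
Proof. by move=> hn hm; rewrite -(fine_add m hn).2 addnC (fine_add n hm).2. Qed.

Lemma fine_ends n g : fine_path n g -> has_ends (Phi n g) (g 0) (g 1).
Proof.
elim: n g => [|n IH] g /=; first by move=> [Y UY dg]; exact: phi_ends dg.
move=> hf; have [a [b [f [ea eb ->]]]] := IH _ (hf false).
have [b' [c [f' [eb' ec ->]]]] := IH _ (hf true).
move: ea eb eb' ec; rewrite bisect00 bisect01 bisect11 => ea -> /arr_ends[eb _] ec.
by subst b'; exists a, c, (comp f f'); split=> //; rewrite acomp_arr.
Qed.

Lemma has_ends_idl m x y : has_ends m x y -> acomp (phi (fun=> x)) m = m.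
Proof. by case=> a [b [f [-> _ ->]]]; rewrite acomp_arr cat_idl. Qed.

Lemma has_ends_idr m x y : has_ends m x y -> acomp m (phi (fun=> y)) = m.
Proof. by case=> a [b [f [_ -> ->]]]; rewrite acomp_arr cat_idr. Qed.

(** Pasting of commuting squares: a small square commutes by [dihom_square], a larger one because
    its four quarters do. *)
Lemma fine_sq_comm n H : fine_sq n H ->
  [/\ forall s, s = 0 \/ s = 1 -> fine_path n (fun t => H (t, s)) /\ fine_path n (fun t => H (s, t)) &
   acomp (Phi n (fun t => H (t, 0))) (Phi n (fun s => H (1, s))) =
   acomp (Phi n (fun s => H (0, s))) (Phi n (fun t => H (t, 1)))].
Proof.
elim: n H => [|n IH] H /=.
  move=> [Y UY dH].
  have eh s : s = 0 \/ s = 1 -> dipath_in Y (fun t => H (t, s)).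
    move=> hs; apply: (dimap_sq_dipath (p := fun t => t) (q := fun=> s) dH).
      exact: nondec01_id.
    by apply: nondec01_cst; case: hs => ->.
  have ev s : s = 0 \/ s = 1 -> dipath_in Y (fun t => H (s, t)).
    move=> hs; apply: (dimap_sq_dipath (p := fun=> s) (q := fun t => t) dH).
      by apply: nondec01_cst; case: hs => ->.
    exact: nondec01_id.
  split; first by move=> s hs; split; exists Y => //; [exact: eh|exact: ev].
  rewrite -!(phi_concat UY) //; try by [apply: eh; auto|apply: ev; auto].
  apply: (phi_dihom UY); last by rewrite concat0 concat1; exact: dihom_square.
  have pb := dipath_in_path (eh 0 (or_introl erefl)).
  have pr := dipath_in_path (ev 1 (or_intror erefl)).
  by case: (path_concat pb pr).
move=> hf; have h i j := IH _ (hf i j).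
have k01 (k : bool) : k%:R = 0 :> R \/ k%:R = 1 :> R by case: k; [right|left].
have hh (j k : bool) i : bisect j k%:R = k%:R :> R -> fine_path n (fun t => H (bisect i t, k%:R)).
  by move=> e; have [/(_ _ (k01 k))[+ _] _] := h i j; rewrite /= e.
have hv (j k : bool) i : bisect j k%:R = k%:R :> R -> fine_path n (fun t => H (k%:R, bisect i t)).
  by move=> e; have [/(_ _ (k01 k))[_ +] _] := h j i; rewrite /= e.
split.
  move=> s [->|->]; split=> i.
  - exact: (hh false false i bisect00).
  - exact: (hv false false i bisect00).
  - exact: (hh true true i bisect11).
  - exact: (hv true true i bisect11).
have [_ /=] := h false false; have [_ /=] := h true false.
have [_ /=] := h false true; have [_ /=] := h true true.
(* The [bisect] identities match the inner edges of neighbouring quarters. The composite is then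
   pushed across the lower right, upper right, lower left and upper left quarter in turn. *)
rewrite bisect00 bisect11 bisect01 => h11 h01 h10 h00.
rewrite !acompA -(acompA _ _ (Phi n (fun t => H (1, bisect true t)))) h10 acompA.
rewrite h11 -!acompA h00 !acompA; congr acomp.
by rewrite -!acompA h01.
Qed.

Lemma dimap_sq_restrict Y H : dimap_sq setT H -> (forall ts, Isq ts -> Y (H ts)) -> dimap_sq Y H.
Proof.
move=> [cH dH] YH; split=> // p q hp hq; split; first by case: (dH _ _ hp hq).
by move=> t tI; apply: YH; split; exact: nondec01_I01.
Qed.

Lemma compact_Isq : compact (@Isq R).
Proof.
rewrite (_ : @Isq R = `[0, 1] `*` `[0, 1]).
  by apply: compact_setX; exact: segment_compact.
by apply/seteqP; split=> t; rewrite /Isq /I01 /= !in_itv.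
Qed.

(* The Lebesgue number lemma for the interiors of the members of [U]. *)
Lemma fine_sq_exists H : dimap_sq setT H -> exists n, fine_sq n H.
Proof.
(* [D n K] says that [2^-n] is a Lebesgue number for [K]. Bisection halves distances, so [D n.+1 K]
   passes to [D n] on each quarter. *)
move=> dH; pose D (n : nat) (K : R * R -> X) := forall p, Isq p -> exists2 Y, U Y &
  forall q, Isq q -> `|p.1 - q.1| <= 2^-1 ^+ n -> `|p.2 - q.2| <= 2^-1 ^+ n -> Y (K q).
have hd i (u v : R) : bisect i u - bisect i v = 2^-1 * (u - v) by rewrite /bisect; ring.
have fineD n K : dimap_sq setT K -> D n K -> fine_sq n K.
  elim: n K => [|n IH] K dK hD /=.
    (* Distance 1 from the corner already covers the whole square. *)
    have [|Y UY hY] := hD (0, 0); first by split.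
    exists Y => //; apply: dimap_sq_restrict => // -[t s] [/= tI sI].
    move: (tI) (sI) => /andP[? ?] /andP[? ?].
    by apply: hY => //=; rewrite sub0r normrN ger0_norm.
  move=> i j; apply: IH.
    by apply: (dimap_sq_prod dK); exact: nondec01_bisect.
  move=> [p1 p2] [/= h1 h2].
  have [|Y UY hY] := hD (bisect i p1, bisect j p2).
    by split; exact: I01_bisect.
  exists Y => // -[q1 q2] [/= h3 h4] d1 d2; apply: hY; first by split; exact: I01_bisect.
  - by rewrite /= hd normrM exprS ger0_norm // ler_pM2l.
  - by rewrite /= hd normrM exprS ger0_norm // ler_pM2l.
suff [n hn] : exists n, D n H by exists n; exact: fineD.
have /continuous_IsqP cH := proj1 dH.
(* Compactness in near-covering form: what holds near each point for all large [n] holds on the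
   whole square for all large [n]. *)
have := (proj1 (@compact_near_coveringP _ _) compact_Isq) nat \oo
  (fun n p => exists2 Y, U Y & forall q, Isq q -> `|p.1 - q.1| <= 2^-1 ^+ n ->
     `|p.2 - q.2| <= 2^-1 ^+ n -> Y (H q)).
case.
- move=> p pI; have [Y UY hY] := Ucover (H p).
  have : nbhs p ((fun q => H (clamp2 q)) @^-1` Y).
    apply: cH; rewrite (_ : clamp2 p = p) //.
    by case: p pI {hY} => u v [/= /clamp_id e1 /clamp_id e2]; rewrite /clamp2 /= e1 e2.
  case/nbhs_ballP => e /= e0 he.
  (* One half of [e] for moving the centre from [p] to [p'], the other for the distance from [p'] to
     [q]. *)
  have e20 : 0 < e / 2 by rewrite divr_gt0.
  near=> p' n; exists Y => // q qI d1 d2.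
  have -> : q = clamp2 q.
    by case: q qI {d1 d2} => u v [/= /clamp_id e1 /clamp_id e2]; rewrite /clamp2 /= e1 e2.
  apply: (he q).
  have hn : 2^-1 ^+ n < e / 2.
    near: n; have := near_infty_natSinv_expn_lt (PosNum e20).
    by apply: filterS => n /=; rewrite div1r exprVn.
  have [b1 b2] : ball p (e / 2) p' by near: p'; exact: nbhsx_ballx.
  split; rewrite /ball /=.
  + move: b1; rewrite /ball /= => b1.
    rewrite (_ : p.1 - q.1 = (p.1 - p'.1) + (p'.1 - q.1)); last by ring.
    apply: le_lt_trans (ler_normD _ _) _; lra.
  + move: b2; rewrite /ball /= => b2.
    rewrite (_ : p.2 - q.2 = (p.2 - p'.2) + (p'.2 - q.2)); last by ring.
    apply: le_lt_trans (ler_normD _ _) _; lra.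
- by move=> N _ /(_ N (leqnn N)) h; exists N.
Unshelve. all: by end_near.
Qed.

(** A path is a square that is constant in its second variable. *)
Lemma fine_exists g : dipath X g -> exists n, fine_path n g.
Proof.
move=> dg; have [n hn] : exists n, fine_sq n (fun ts => g ts.1).
  by apply: fine_sq_exists; apply: dimap_sq_path; split.
by exists n; have [/(_ 0 (or_introl erefl))[]] := fine_sq_comm hn.
Qed.

Definition extension g : arrow E :=
  match pselect (exists n, fine_path n g) with
  | left e => Phi (sval (cid e)) g
  | right _ => None
  end.

Lemma extension_fine n g : fine_path n g -> extension g = Phi n g.
Proof.
rewrite /extension; case: pselect => [e|ne] hn; last by case: ne; exists n.
by case: (cid e) => m hm /=; exact: Phi_indep.
Qed.

Lemma extension_local Y g : U Y -> dipath_in Y g -> extension g = phi g.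
Proof. by move=> UY dg; rewrite (@extension_fine 0) //; exists Y. Qed.

Lemma extension_ends g : dipath X g -> has_ends (extension g) (g 0) (g 1).
Proof. by case/fine_exists => n hn; rewrite (extension_fine hn); exact: fine_ends. Qed.

Lemma extension_concat g h : dipath X g -> dipath X h -> g 1 = h 0 ->
  extension (concat g h) = acomp (extension g) (extension h).
Proof.
move=> /fine_exists[n hn] /fine_exists[m hm] e.
have [gn en] := fine_add m hn; have [hm' em] := fine_add n hm.
rewrite addnC in hm' em *.
have [f0 e0] : fine_path (m + n) (fun t => concat g h (bisect false t)) /\
    Phi (m + n) g = Phi (m + n) (fun t => concat g h (bisect false t)).
  apply: fine_ext => // t /andP[t0 t1]; rewrite /concat /bisect ifT; last lra.
  by congr g; lra.
have [f1 e1] : fine_path (m + n) (fun t => concat g h (bisect true t)) /\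
    Phi (m + n) h = Phi (m + n) (fun t => concat g h (bisect true t)).
  (* At [t = 0] the right half still falls into the left branch of [concat], with value [g 1]. *)
  apply: fine_ext => // t /andP[t0 t1]; rewrite /concat /bisect; case: ifP => ht.
    have -> : t = 0 by lra.
    by rewrite -e; congr g; lra.
  by congr h; lra.
rewrite (@extension_fine (m + n).+1) /=; last by case.
by rewrite -e0 -e1 (extension_fine gn) (extension_fine hm').
Qed.

(* The sides of a homotopy are constant, so the square relation reduces to an equality. *)
Lemma extension_dhtpy a b g g' : dhtpy setT a b g g' -> extension g = extension g'.
Proof.
case=> H [dH [H0 [H1 Hs]]]; have [n hn] := fine_sq_exists dH.
have [hf] := fine_sq_comm hn.
have [hb hl] := hf 0 (or_introl erefl); have [ht hr] := hf 1 (or_intror erefl).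
have [fb eb] := fine_ext hb H0; have [ft et] := fine_ext ht H1.
have cst x : fine_path n (fun=> x) /\ Phi n (fun=> x) = phi (fun=> x).
  have [Y UY /nbhs_singleton Yx] := Ucover x.
  have : fine_path 0 (fun=> x) by exists Y => //; exact: dipath_in_cst.
  by move=> /(fine_add n); rewrite addn0.
have [_ el] := fine_ext hl (fun s sI => (Hs s sI).1).
have [_ er] := fine_ext hr (fun s sI => (Hs s sI).2).
rewrite el er eb et (cst a).2 (cst b).2 (extension_fine fb) (extension_fine ft).
have := fine_ends fb; have := fine_ends ft.
rewrite -!H0 // -!H1 // (Hs 0 _).1 // (Hs 0 _).2 // (Hs 1 _).1 // (Hs 1 _).2 //.
by move=> /has_ends_idl -> /has_ends_idr ->.
Qed.

Lemma extension_dihom a b g g' : dihom setT a b g g' -> extension g = extension g'.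
Proof.
by elim=> {g g'} [g g' /extension_dhtpy|//|g g' _ ->|g1 g2 g3 _ -> _ ->].
Qed.

End LocalToGlobal.

Lemma is_functor_comp (C D E : PreCat) (F : FunctorData C D) (G : FunctorData D E) :
  is_functor F -> is_functor G -> is_functor (fcomp F G).
Proof.
by case=> Fi Fc [Gi Gc]; split=> [a|a b c f g] /=; [rewrite Fi Gi|rewrite Fc Gc].
Qed.

Lemma arr_fmor (C D : PreCat) (F : FunctorData C D) (a b a' b' : Ob C)
    (f : Mor C a b) (f' : Mor C a' b') : arr f = arr f' -> arr (fmor F f) = arr (fmor F f').
Proof.
move=> e; have [ea eb] := arr_ends e; subst a' b'.
by rewrite (arr_inj e).
Qed.

(** * Members of classes and local values *)

Section Classes.
Variables (R : realType) (X : dspace R).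
Implicit Types (Y A : set X) (g h : R -> X).

Lemma arr_eq Y A (hAY : A `<=` Y) (a b a' b' : Ob (pi hAY)) (f : Mor (pi hAY) a b)
    (f' : Mor (pi hAY) a' b') g : sval f g -> sval f' g -> arr f = arr f'.
Proof.
move=> fg fg'; have [_ [g0 g1]] := class_path fg; have [_ [g0' g1']] := class_path fg'.
have ea : a = a' by apply: sig_eq; rewrite -g0 g0'.
have eb : b = b' by apply: sig_eq; rewrite -g1 g1'.
by subst a' b'; rewrite (mor_eq fg fg').
Qed.

Lemma class_dihom Y A (hAY : A `<=` Y) (a b : Ob (pi hAY)) (f : Mor (pi hAY) a b) g h :
  sval f g -> sval f h -> dihom Y (sval a) (sval b) g h.
Proof. by move=> fg; rewrite (class_of_path fg) => -[]. Qed.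

Lemma class_closed Y A (hAY : A `<=` Y) (a b : Ob (pi hAY)) (f : Mor (pi hAY) a b) g h :
  sval f g -> dihom Y (sval a) (sval b) g h -> sval f h.
Proof.
move=> fg hd; have pg := class_path fg; rewrite (class_of_path fg); split=> //.
by case: (path_dihom pg hd).
Qed.

Lemma dipath_in_between Y g : dipath_in Y g -> dipath_between Y Y g.
Proof. by move=> dg; split=> //; apply: dg.2. Qed.

(** Supplies the three hypotheses on [phi] of the extension for one member of the cover. [phi] is
    tied to [F] only on [Y], since a single [phi] has to serve both members. *)
Lemma path_val_local Y (E : Category) (F : FunctorData (@pi R X Y Y (@subrefl R X Y)) E)
    (phi : (R -> X) -> arrow E) : is_functor F ->
  (forall g, dipath_in Y g -> phi g = path_val F g) ->
  [/\ forall g g', dipath_in Y g -> dihom Y (g 0) (g 1) g g' -> phi g = phi g',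
      forall g h, dipath_in Y g -> dipath_in Y h -> g 1 = h 0 ->
        phi (concat g h) = acomp (phi g) (phi h) &
      forall g, dipath_in Y g -> has_ends phi (phi g) (g 0) (g 1)].
Proof.
move=> hF hphi; split=> [g g' dg hd|g h dg dh e|g dg].
- have [dg' _] := path_dihom (dipath_in_path dg) hd.
  by rewrite !hphi //; apply: path_val_dihom hd; exact: dipath_in_between.
- have dgh : dipath_in Y (concat g h).
    by have [] := path_concat (dipath_in_path dg) (conj dh (conj (esym e) erefl)).
  by rewrite !hphi // path_val_concat //; exact: dipath_in_between.
- have [a [b [f [fg ea eb]]]] := path_mor (@subrefl R X Y) (dipath_in_between dg).
  exists (fob F a), (fob F b), (fmor F f).
  rewrite -ea -eb !hphi //; first by rewrite !path_val_cst // (path_val_class F fg).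
  + by apply: dipath_in_cst; exact: (svalP b).
  + by apply: dipath_in_cst; exact: (svalP a).
Qed.
End Classes.

(** * Units of one future retract, on representatives *)

Section Retract.
Variables (R : realType) (X : dspace R) (Y A : set X) (hAY : A `<=` Y).
Let CB := @pi R X Y Y (@subrefl R X Y).
Let CA := @pi R X Y A hAY.
Let iota : FunctorData CA CB := incl hAY (@subrefl R X Y) (@subrefl R X Y) hAY.
Variables (P : FunctorData CB CA) (eta : forall x : Ob CB, Mor CB x (fob iota (fob P x))).
Implicit Types (g e : R -> X).

(** Indexed by a point of [X] instead of an object, so that units of retracts over different subsets
    can be compared. *)
Definition unit_path (x : X) e := exists2 z : Ob CB, sval z = x & sval (eta z) e.

Lemma unit_path_from_to x e : unit_path x e -> path_from_to Y x (e 1) e /\ A (e 1).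
Proof.
case=> z <- ze; have [dz [e0 e1]] := class_path ze.
by split=> //; rewrite e1; exact: (svalP (fob P z)).
Qed.

Lemma unit_path_dihom x e e' : unit_path x e -> unit_path x e' -> dihom Y x (e 1) e e'.
Proof.
move=> [z zx ze] [z' zx' ze'].
have E : z' = z by apply: sig_eq; rewrite zx zx'.
subst z'; have [_ [_ ->]] := class_path ze; rewrite -zx; exact: class_dihom ze ze'.
Qed.

Lemma unit_path_exists x : Y x -> exists e, unit_path x e.
Proof. by move=> Yx; exists (rep (eta (exist _ x Yx))), (exist _ x Yx) => //; exact: rep_in. Qed.

Hypothesis hP : future_retract eta.

(** [d] represents [P] applied to the class of [g], and the homotopy is the naturality square of the
    unit. *)
Lemma unit_path_naturality g e e' : dipath_in Y g -> unit_path (g 0) e -> unit_path (g 1) e' ->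
  exists d, [/\ dipath_between Y A d, path_from_to Y (e 1) (e' 1) d,
    dihom Y (g 0) (e' 1) (concat g e') (concat e d) &
    forall E (h : FunctorData CA E), path_val (fcomp P h) g = path_val h d].
Proof.
case: hP => _ [nat _] dg [x xg xe] [y yg ye].
have [f fg] := @mor_of_path R X Y Y (@subrefl R X Y) x y g (conj dg (conj (esym xg) (esym yg))).
have [_ [_ e1]] := class_path xe; have [_ [_ e1']] := class_path ye.
pose d := rep (fmor P f); have fd : sval (fmor P f) d by exact: rep_in.
have pd := class_path fd; exists d; split.
- case: pd => dd [d0 d1]; split=> //; first by rewrite d0; exact: (svalP (fob P x)).
  by rewrite d1; exact: (svalP (fob P y)).
- by rewrite e1 e1'.
- rewrite -xg e1'; apply: (class_dihom (comp_in fg ye)); rewrite nat.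
  by apply: comp_in xe _; exact: incl_in.
- by move=> E h; rewrite (path_val_class _ fg) (path_val_class _ fd).
Qed.

Lemma unit_path_cst x : A x -> unit_path x (fun=> x).
Proof.
move=> Ax; pose a : Ob CA := exist _ x Ax; exists (fob iota a) => //.
case: hP => _ [_ [_ /(_ a)]].
(* The normalization of the unit is an equality of dependent pairs; membership is stated for an
   arbitrary pair [u] so that it can be rewritten. *)
have : forall u, u = existT (fun y => Mor CB (fob iota a) y) (fob iota a) (idm (fob iota a)) ->
   sval (projT2 u) (fun=> x).
  by move=> u ->; exact: (idm_in (fob iota a)).
by move=> /[apply].
Qed.

(** Over [A] the unit is constant, so its naturality square collapses to a homotopy between a path
    and a representative of its retraction. *)
Lemma retract_arr (a b : Ob CA) (f : Mor CA a b) : arr (fmor P (fmor iota f)) = arr f.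
Proof.
have pg := rep_path f; have [dg [g0 g1]] := pg.
have [d [_ pd hd hv]] := unit_path_naturality dg
  (unit_path_cst (eq_ind_r A (svalP a) g0)) (unit_path_cst (eq_ind_r A (svalP b) g1)).
have fd : sval f d.
  apply: (class_closed (rep_in f)); rewrite /= g0 g1 in pd hd.
  apply: rst_trans (dihom_concat_cst pg) _; apply: rst_trans hd _.
  by apply: rst_sym; exact: dihom_cst_concat.
(* [hv] compares values under functors out of [CA]; the identity functor makes it a statement on [P]
   itself. *)
pose idF : FunctorData CA CA := @Build_FunctorData CA CA id (fun _ _ => id).
have := hv _ idF; rewrite (path_val_class idF fd) => <-.
by rewrite (path_val_class (fcomp P idF) (incl_in (@subrefl R X Y) (@subrefl R X Y) hAY (rep_in f))).
Qed.

End Retract.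

(** * Gluing the units of the compatible retracts *)

Section Pushout.
Variables (R : realType) (X : dspace R) (X1 X2 A1 A2 : set X).
Hypothesis hcov : [set: X] = interior X1 `|` interior X2.
Variables (hA1 : A1 `<=` X1) (hA2 : A2 `<=` X2).
Variables (P0 : FunctorData (piB0 X1 X2) (piA0 hA1 hA2))
  (P1 : FunctorData (piB1 X1) (piA1 hA1)) (P2 : FunctorData (piB2 X2) (piA2 hA2))
  (eta0 : forall x : Ob (piB0 X1 X2), Mor (piB0 X1 X2) x (fob (iota0 hA1 hA2) (fob P0 x)))
  (eta1 : forall x : Ob (piB1 X1), Mor (piB1 X1) x (fob (iota1 hA1) (fob P1 x)))
  (eta2 : forall x : Ob (piB2 X2), Mor (piB2 X2) x (fob (iota2 hA2) (fob P2 x))).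
Hypothesis hP : compatible_future_retracts eta0 eta1 eta2.
Implicit Types (g e : R -> X).

Lemma inclusion_square : fcomp (i1' hA1 hA2) (j1' A2 hA1) = fcomp (i2' hA1 hA2) (j2' A1 hA2).
Proof.
apply: functor_eq => a b f.
by apply: (@arr_eq R X _ _ _ _ _ _ _ _ _ (rep f)); do 2!apply: incl_in; exact: rep_in.
Qed.

Definition global_unit_path x e := unit_path eta1 x e \/ unit_path eta2 x e.

Lemma global_unit_path_from_to x e : global_unit_path x e ->
  path_from_to setT x (e 1) e /\ (A1 `|` A2) (e 1).
Proof.
by case=> /unit_path_from_to [[[de _] he] Ae]; do 2?split=> //; [left|right].
Qed.

(** Compatibility of the units: a representative of [eta0] at [x] serves for [eta1] and [eta2]
    alike. *)
Lemma unit_path0 x : X1 x -> X2 x -> exists2 e, unit_path eta1 x e & unit_path eta2 x e.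
Proof.
move=> x1 x2; pose z : Ob (piB0 X1 X2) := exist _ x (conj x1 x2).
case: hP => _ [_ [_ [_ [_ [h1 h2]]]]].
pose e := rep (eta0 z); have ze : sval (eta0 z) e by exact: rep_in.
exists e.
- exists (fob (i1 X1 X2) z) => //.
  have : forall u, existT (fun y => Mor (piB1 X1) (fob (i1 X1 X2) z) y) _ (fmor (i1 X1 X2) (eta0 z)) = u ->
    sval (projT2 u) e by move=> u <-; exact: incl_in.
  by move/(_ _ (h1 z)).
- exists (fob (i2 X1 X2) z) => //.
  have : forall u, existT (fun y => Mor (piB2 X2) (fob (i2 X1 X2) z) y) _ (fmor (i2 X1 X2) (eta0 z)) = u ->
    sval (projT2 u) e by move=> u <-; exact: incl_in.
  by move/(_ _ (h2 z)).
Qed.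

(** If one path comes from [eta1] and the other from [eta2], then [x] lies in both sets, and the
    common representative given by [unit_path0] links them. *)
Lemma global_unit_path_dihom x e e' : global_unit_path x e -> global_unit_path x e' ->
  dihom setT x (e 1) e e'.
Proof.
have same1 k k' : unit_path eta1 x k -> unit_path eta1 x k' -> dihom setT x (k 1) k k'.
  by move=> h h'; apply: dihom_sub (unit_path_dihom h h').
have same2 k k' : unit_path eta2 x k -> unit_path eta2 x k' -> dihom setT x (k 1) k k'.
  by move=> h h'; apply: dihom_sub (unit_path_dihom h h').
have mixed k k' : unit_path eta1 x k -> unit_path eta2 x k' -> dihom setT x (k 1) k k'.
  move=> h h'; have [[z z1 _] [z' z2 _]] := (h, h').
  have [k0 h0 h0'] : exists2 k0, unit_path eta1 x k0 & unit_path eta2 x k0.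
    by apply: unit_path0; [rewrite -z1; exact: (svalP z)|rewrite -z2; exact: (svalP z')].
  have hd := same1 _ _ h h0; have [pk _] := global_unit_path_from_to (or_introl h).
  by have [_ [_ e1]] := path_dihom pk hd; apply: rst_trans hd _; rewrite -e1; exact: same2.
move=> [h|h] [h'|h']; [exact: same1|exact: mixed| |exact: same2].
have hd := mixed _ _ h' h; have [pk _] := global_unit_path_from_to (or_introl h').
by have [_ [_ ->]] := path_dihom pk hd; exact: rst_sym.
Qed.

Lemma global_unit_path_cst x : (A1 `|` A2) x -> global_unit_path x (fun=> x).
Proof.
case: hP => _ [h1 [h2 _]].
by case=> Ax; [left; exact: unit_path_cst h1 _ Ax|right; exact: unit_path_cst h2 _ Ax].
Qed.

Definition cover12 : set (set X) := [set Y | Y = X1 \/ Y = X2].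

Lemma cover12_nbhs (x : X) : exists2 Y, cover12 Y & nbhs x Y.
Proof.
have : [set: X] x by [].
by rewrite hcov => -[h|h]; [exists X1; [left|]|exists X2; [right|]].
Qed.

(** * The functor induced by a cocone *)

Section Target.
Variables (E : Category) (h1 : FunctorData (piA1 hA1) E) (h2 : FunctorData (piA2 hA2) E).
Hypotheses (fh1 : is_functor h1) (fh2 : is_functor h2)
  (h12 : fcomp (i1' hA1 hA2) h1 = fcomp (i2' hA1 hA2) h2).

Let F1 : FunctorData (piB1 X1) E := fcomp P1 h1.
Let F2 : FunctorData (piB2 X2) E := fcomp P2 h2.

Definition local_val g : arrow E :=
  match pselect (dipath_in X1 g) with
  | left _ => path_val F1 g
  | right _ => path_val F2 g
  end.

Lemma local_val1 g : dipath_in X1 g -> local_val g = path_val F1 g.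
Proof. by rewrite /local_val; case: pselect. Qed.

(** [local_val] favours [X1]. For a path in both sets the choice is immaterial: [P1] and [P2] both
    restrict to [P0], after which [h12] applies. *)
Lemma local_val2 g : dipath_in X2 g -> local_val g = path_val F2 g.
Proof.
rewrite /local_val; case: pselect => // dg1 dg2.
have dg : dipath_between (X1 `&` X2) (X1 `&` X2) g.
  by apply: dipath_in_between; split; [exact: dg1.1|move=> t tI; split; [exact: dg1.2|exact: dg2.2]].
rewrite (path_val_incl (@subrefl R X _) (@subIsetl _ X1 X2) (@subIsetl _ X1 X2) F1 dg).
rewrite (path_val_incl (@subrefl R X _) (@subIsetr _ X1 X2) (@subIsetr _ X1 X2) F2 dg).
congr (path_val _ g).
case: hP => _ [_ [_ [e1 [e2 _]]]].
rewrite -[LHS]/(fcomp (fcomp (i1 X1 X2) P1) h1) -[RHS]/(fcomp (fcomp (i2 X1 X2) P2) h2) e1 e2.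
by rewrite -[LHS]/(fcomp P0 (fcomp (i1' hA1 hA2) h1)) h12.
Qed.

Lemma local_valP : [/\ forall Y g g', cover12 Y -> dipath_in Y g ->
    dihom Y (g 0) (g 1) g g' -> local_val g = local_val g',
  forall Y g h, cover12 Y -> dipath_in Y g -> dipath_in Y h -> g 1 = h 0 ->
    local_val (concat g h) = acomp (local_val g) (local_val h) &
  forall Y g, cover12 Y -> dipath_in Y g -> has_ends local_val (local_val g) (g 0) (g 1)].
Proof.
case: (hP) => _ [[fP1 _] [[fP2 _] _]].
have [a1 b1 c1] := path_val_local (is_functor_comp fP1 fh1) local_val1.
have [a2 b2 c2] := path_val_local (is_functor_comp fP2 fh2) local_val2.
split.
- by move=> Y g g' [] ->; [exact: a1|exact: a2].
- by move=> Y g h [] ->; [exact: b1|exact: b2].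
- by move=> Y g [] ->; [exact: c1|exact: c2].
Qed.

Let global_val g := extension cover12 local_val g.

Lemma global_val_ob (a : Ob (piA A1 A2)) :
  exists o, local_val (fun=> sval a) = arr (idm o).
Proof.
have [hd hc he] := local_valP.
have [Y UY /nbhs_singleton Ya] := cover12_nbhs (sval a).
by have [c [_ [_ [e _ _]]]] := he _ _ UY (dipath_in_cst Ya); exists c.
Qed.

(** Read off from the identity arrow that [local_val] assigns to the constant path, which determines
    the object. *)
Definition glue_ob (a : Ob (piA A1 A2)) : Ob E := sval (cid (global_val_ob a)).

Lemma glue_obE a : local_val (fun=> sval a) = arr (idm (glue_ob a)).
Proof. by rewrite /glue_ob; case: cid. Qed.

Lemma global_val_mor (a b : Ob (piA A1 A2)) (f : Mor (piA A1 A2) a b) :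
  exists m : Mor E (glue_ob a) (glue_ob b), global_val (rep f) = arr m.
Proof.
have [hd hc he] := local_valP; have [[df _] [f0 f1]] := rep_path f.
have := extension_ends cover12_nbhs hd hc he df; rewrite f0 f1.
case=> c [c' [m [ec ec' em]]].
move: ec ec'; rewrite !glue_obE => /arr_ends[ec _] /arr_ends[ec' _].
by subst c c'; exists m.
Qed.

Definition glue : FunctorData (piA A1 A2) E :=
  @Build_FunctorData (piA A1 A2) E glue_ob (fun a b f => sval (cid (global_val_mor f))).

Lemma glueE (a b : Ob (piA A1 A2)) (f : Mor (piA A1 A2) a b) g :
  sval f g -> arr (fmor glue f) = global_val g.
Proof.
move=> fg; have [hd hc he] := local_valP.
rewrite /global_val -(extension_dihom cover12_nbhs hd hc he (rep_dihom fg)) /=.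
by case: cid => m /= <-.
Qed.

Lemma is_functor_glue : is_functor glue.
Proof.
have [hd hc he] := local_valP; split=> [a|a b c f f'].
  apply: arr_inj; rewrite (glueE (idm_in a)) -[RHS]/(arr (idm (glue_ob a))) -glue_obE.
  have [Y UY /nbhs_singleton Ya] := cover12_nbhs (sval a).
  exact: (extension_local hc UY (dipath_in_cst Ya)).
have [[df _] [f0 f1]] := rep_path f; have [[df' _] [f0' f1']] := rep_path f'.
apply: arr_inj; rewrite -acomp_arr (glueE (comp_in (rep_in f) (rep_in f'))).
rewrite (glueE (rep_in f)) (glueE (rep_in f')).
by apply: (extension_concat cover12_nbhs hd hc df df'); rewrite f1 f0'.
Qed.

(** A path in [X1] is fine at depth 0, so its global value is that of [h1] after [P1], and [P1]
    fixes the classes coming from [A1]. *)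
Lemma glue1 : fcomp (j1' A2 hA1) glue = h1.
Proof.
have [hd hc he] := local_valP.
apply: functor_eq => a b f; have [df _] := rep_path f.
case: (hP) => _ [r1 _].
have -> : arr (fmor (fcomp (j1' A2 hA1) glue) f) = global_val (rep f).
  exact: (glueE (incl_in (@subT R X _) (@subT R X X1) (@subsetUl _ A1 A2) (rep_in f))).
rewrite /global_val (extension_local hc (or_introl erefl) df) local_val1 //.
rewrite (path_val_class F1 (incl_in (@subrefl R X X1) (@subrefl R X X1) hA1 (rep_in f))).
exact: arr_fmor (retract_arr r1 f).
Qed.

Lemma glue2 : fcomp (j2' A1 hA2) glue = h2.
Proof.
have [hd hc he] := local_valP.
apply: functor_eq => a b f; have [df _] := rep_path f.
case: (hP) => _ [_ [r2 _]].
have -> : arr (fmor (fcomp (j2' A1 hA2) glue) f) = global_val (rep f).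
  exact: (glueE (incl_in (@subT R X _) (@subT R X X2) (@subsetUr _ A1 A2) (rep_in f))).
rewrite /global_val (extension_local hc (or_intror erefl) df) local_val2 //.
rewrite (path_val_class F2 (incl_in (@subrefl R X X2) (@subrefl R X X2) hA2 (rep_in f))).
exact: arr_fmor (retract_arr r2 f).
Qed.

(** * Uniqueness of the induced functor *)

Section Uniqueness.
Variable k : FunctorData (piA A1 A2) E.
Hypotheses (fk : is_functor k) (k1 : fcomp (j1' A2 hA1) k = h1) (k2 : fcomp (j2' A1 hA2) k = h2).

(** The given units may come from the set that does not contain [g]. The naturality square is built
    with units of the set that does, then corrected by [global_unit_path_dihom]. *)
Lemma fine0_naturality g e e' : fine_path cover12 0 g ->
  global_unit_path (g 0) e -> global_unit_path (g 1) e' ->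
  exists d, [/\ path_from_to setT (e 1) (e' 1) d,
    dihom setT (g 0) (e' 1) (concat g e') (concat e d) & path_val k d = local_val g].
Proof.
move=> [Y UY dg] he he'.
have [pe _] := global_unit_path_from_to he; have [pe' _] := global_unit_path_from_to he'.
have pg : path_from_to setT (g 0) (g 1) g by split=> //; exact: dipath_in_sub dg.
have [e0 [e0' [d [he0 he0' pd hd hv]]]] : exists e0 e0' d,
    [/\ global_unit_path (g 0) e0, global_unit_path (g 1) e0',
     path_from_to setT (e0 1) (e0' 1) d,
     dihom setT (g 0) (e0' 1) (concat g e0') (concat e0 d) & path_val k d = local_val g].
  case: (hP) => _ [r1 [r2 _]]; case: UY => eY; subst Y.
  - have [e0 he0] := unit_path_exists eta1 (dg.2 _ (I01_0 R)).
    have [e0' he0'] := unit_path_exists eta1 (dg.2 _ (I01_1 R)).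
    have [d [bd [dd pd] hd hv]] := unit_path_naturality r1 dg he0 he0'.
    exists e0, e0', d; split; [by left|by left| | |].
    + by split=> //; exact: dipath_in_sub dd.
    + exact: dihom_sub hd.
    + rewrite local_val1 // hv -k1.
      exact: (path_val_incl hA1 (@subT R X X1) (@subsetUl _ A1 A2) k bd).
  - have [e0 he0] := unit_path_exists eta2 (dg.2 _ (I01_0 R)).
    have [e0' he0'] := unit_path_exists eta2 (dg.2 _ (I01_1 R)).
    have [d [bd [dd pd] hd hv]] := unit_path_naturality r2 dg he0 he0'.
    exists e0, e0', d; split; [by right|by right| | |].
    + by split=> //; exact: dipath_in_sub dd.
    + exact: dihom_sub hd.
    + rewrite local_val2 // hv -k2.
      exact: (path_val_incl hA2 (@subT R X X2) (@subsetUr _ A1 A2) k bd).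
have [pe0 _] := global_unit_path_from_to he0; have [pe0' _] := global_unit_path_from_to he0'.
have ee := global_unit_path_dihom he he0; have ee' := global_unit_path_dihom he' he0'.
have [_ [_ e1]] := path_dihom pe ee; have [_ [_ e1']] := path_dihom pe' ee'.
rewrite e1 e1' in pd hd pe0 pe0'; exists d; split=> //.
apply: (rst_trans _ _ _ (concat g e0')); first by apply: dihom_concat pg pe' _ ee'; exact: rst_refl.
apply: rst_trans hd _; apply: rst_sym; apply: dihom_concat pe pd ee _; exact: rst_refl.
Qed.

(** Naturality squares of the two halves are pasted along a unit [e''] at the midpoint. The midpoint
    itself may lie outside [A], but [e''] ends in [A], so that [k] can be evaluated on both pieces
    [d1] and [d2]. *)
Lemma fine_naturality n g e e' : fine_path cover12 n g ->
  global_unit_path (g 0) e -> global_unit_path (g 1) e' ->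
  exists d, [/\ path_from_to setT (e 1) (e' 1) d,
    dihom setT (g 0) (e' 1) (concat g e') (concat e d) & path_val k d = Phi local_val n g].
Proof.
elim: n g e e' => [|n IH] g e e'; first exact: fine0_naturality.
move=> hf he he'.
have [e'' he''] : exists e'', global_unit_path (g (bisect true 0)) e''.
  have [Y [->|->] /nbhs_singleton Yx] := cover12_nbhs (g (bisect true 0)).
  - by have [u hu] := unit_path_exists eta1 Yx; exists u; left.
  - by have [u hu] := unit_path_exists eta2 Yx; exists u; right.
have [pe Ae] := global_unit_path_from_to he; have [pe' Ae'] := global_unit_path_from_to he'.
have [pe'' Ae''] := global_unit_path_from_to he''.
have [|| d1 [pd1 hd1 v1]] := IH _ e e'' (hf false).
- by rewrite bisect00.
- by rewrite bisect01.
have [|| d2 [pd2 hd2 v2]] := IH _ e'' e' (hf true).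
- by [].
- by rewrite bisect11.
rewrite bisect00 in hd1.
have dhalf i : path_from_to setT (g (bisect i 0)) (g (bisect i 1)) (fun t => g (bisect i t)).
  (* The pieces of a fine path are dipaths, and [concat_bisect] reassembles the path from them. *)
  suff h m q : fine_path cover12 m q -> dipath X q.
    by split=> //; split=> //; exact: h (hf i).
  elim: m q => [|m IHm] q /=; first by case=> Y _ [].
  move=> hq; rewrite -(concat_bisect q); apply: dipath_concat; [exact: IHm|exact: IHm|].
  by rewrite bisect01.
have pl := dhalf false; have pr := dhalf true.
rewrite bisect00 bisect01 in pl; rewrite bisect11 in pr.
exists (concat d1 d2); split.
- exact: path_concat pd1 pd2.
(* With [l] and [r] the halves of [g], the chain is [(l r) e'], [l (r e')], [l (e'' d2)],
   [(l e'') d2], [(e d1) d2], [e (d1 d2)]. *)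
- rewrite -{2}(concat_bisect g).
  apply: rst_trans (dihom_concatA pl pr pe') _.
  apply: rst_trans (dihom_concat pl (path_concat pr pe') (rst_refl _ _ _) hd2) _.
  apply: rst_trans (rst_sym _ _ _ _ (dihom_concatA pl pe'' pd2)) _.
  apply: rst_trans (dihom_concat (path_concat pl pe'') pd2 hd1 (rst_refl _ _ _)) _.
  exact: dihom_concatA pe pd1 pd2.
- case: (pd1) (pd2) => [dd1 [d10 d11]] [dd2 [d20 d21]].
  rewrite /= -v1 -v2; apply: path_val_concat => //; last by rewrite d11 d20.
  + by split=> //; [rewrite d10|rewrite d11].
  + by split=> //; [rewrite d20|rewrite d21].
Qed.

(** At ends in [A] the units can be taken constant, so naturality makes the path homotopic to some
    [d] whose value under [k] is the composite of local values that defines [glue]. *)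
Lemma glue_unique : glue = k.
Proof.
have [hd hc he] := local_valP.
apply: functor_eq => a b f; rewrite (glueE (rep_in f)).
have pg := rep_path f; have [[dg _] [g0 g1]] := pg.
have [n hn] := fine_exists cover12_nbhs hd hc dg.
have := fine_naturality hn (global_unit_path_cst (eq_ind_r (A1 `|` A2) (svalP a) g0))
  (global_unit_path_cst (eq_ind_r (A1 `|` A2) (svalP b) g1)).
rewrite /= g0 g1 => -[d [pd hdd hv]].
rewrite /global_val (extension_fine hc hn) -hv.
apply: path_val_class; apply: (class_closed (rep_in f)).
apply: rst_trans (dihom_concat_cst pg) _; apply: rst_trans hdd _.
by apply: rst_sym; exact: dihom_cst_concat.
Qed.

End Uniqueness.
End Target.
End Pushout.

Theorem theorem4p2 (R : realType) (X : dspace R) (X1 X2 A1 A2 : set X)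
  (hcov : [set: X] = interior X1 `|` interior X2)
  (hcat : forall g, dipath X g -> fin_concat X1 X2 g)
  (hA1 : A1 `<=` X1) (hA2 : A2 `<=` X2)
  (hAcov : A1 `|` A2 = relint (A1 `|` A2) A1 `|` relint (A1 `|` A2) A2)
  (P0 : FunctorData (piB0 X1 X2) (piA0 hA1 hA2))
  (P1 : FunctorData (piB1 X1) (piA1 hA1))
  (P2 : FunctorData (piB2 X2) (piA2 hA2))
  (eta0 : forall x : Ob (piB0 X1 X2), Mor (piB0 X1 X2) x (fob (iota0 hA1 hA2) (fob P0 x)))
  (eta1 : forall x : Ob (piB1 X1), Mor (piB1 X1) x (fob (iota1 hA1) (fob P1 x)))
  (eta2 : forall x : Ob (piB2 X2), Mor (piB2 X2) x (fob (iota2 hA2) (fob P2 x)))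
  (hP : @compatible_future_retracts R X X1 X2 A1 A2 hA1 hA2 P0 P1 P2 eta0 eta1 eta2) :
  is_pushout (i1' hA1 hA2) (i2' hA1 hA2) (j1' A2 hA1) (j2' A1 hA2).
Proof.
split; first exact: inclusion_square.
move=> E h1 h2 fh1 fh2 h12; exists (glue hcov hP fh1 fh2 h12); split.
  split; first exact: is_functor_glue.
  by split; [exact: glue1|exact: glue2].
by move=> k [fk [k1 k2]]; exact: glue_unique.
Qed.
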